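(* Let $\mathbb{F}_q$ be the finite field with $q$ elements, $d\ge 2$, $t\in\mathbb{F}_q\setminus\{0\}$, $E\subseteq\mathbb{F}_q^d$. Let $n\ge 4$, write $n=2k$ or $n=2k+1$ with $k$ an integer, and let $0<\delta<\frac{1}{2\lfloor n/2\rfloor^2}$. Set $K_4=48$, $K_n=36+80\cdot 6^{\lfloor n/2\rfloor-2}+12\lfloor n/2\rfloor$ for $n\ge5$, $c_n=(n-1)^{n-3}\cdot 2^{\binom{n-1}{2}-n+3}$, and $$\varepsilon=\begin{cases}1-\frac{k-2}{k-1}+\delta & n=2k,\\ 1-\frac{2k-3}{2k-1}+\delta & n=2k+1.\end{cases}$$ Then for $q$ sufficiently large, if $$|E|\ge\begin{cases} q^{\frac12\left(d+2-\frac{k-2}{k-1}+\delta\right)} & n=2k,\\ q^{\frac12\left(d+2-\frac{2k-3}{2k-1}+\delta\right)} & n=2k+1,\end{cases}$$ then $$\left|\mathcal{N}_n^{dist}-\frac{|E|^n}{q^n}\right|\le \frac{|E|^n}{q^n}\left(K_nq^{-\left(\frac{n}{2}-1\right)\delta}+2nq^{-\frac{2}{n-1}}+c_nq^{-\frac{d-3}{2}-\varepsilon}\right),$$ and the same estimate holds with $\mathcal{N}_n^{dist}$ replaced by $\mathcal{N}_n^{prod}$.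
   Context: For $x\in\mathbb{F}_q^d$, $\|x\|=x_1^2+\dots+x_d^2$ and $x\cdot y=\sum_i x_iy_i$. $\mathcal{N}_n^{dist}$ is the number of $n$-tuples $(x_1,\dots,x_n)\in E^n$ with $x_i\neq x_j$ for $i\ne j$, $\|x_i-x_{i+1}\|=t$ for $1\le i\le n-1$, and $\|x_n-x_1\|=t$ (non-degenerate cycles of length $n$ in the distance graph on $E$). $\mathcal{N}_n^{prod}$ is defined the same way with $x_i\cdot x_{i+1}=t$ and $x_n\cdot x_1=t$.
   Formalization: The estimate for N_n^dist is stated for odd q only; for q a power of 2, n odd, d≥3 and E=F_q^d there are no such cycles (N_n^dist=0) while the error factor tends to 0, so the claim fails; the N_n^prod estimate keeps every q. *)

(* Defs.v *)
From HB Require Import structures.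
From mathcomp Require Import all_boot all_order all_algebra.
From mathcomp Require Import reals exp.

Set Implicit Arguments.
Unset Strict Implicit.
Unset Printing Implicit Defensive.

Import Order.TTheory GRing.Theory Num.Theory.
Local Open Scope ring_scope.

Section FiniteFieldGraphs.
Variables (F : finFieldType) (d : nat).
Implicit Types (x y : 'rV[F]_d) (t : F).

Definition normsq x : F := \sum_i x 0 i ^+ 2.
Definition dotp x y : F := \sum_i x 0 i * y 0 i.

Definition dist_rel t : rel 'rV[F]_d := fun x y => normsq (x - y) == t.
Definition prod_rel t : rel 'rV[F]_d := fun x y => dotp x y == t.

(* [cycle e x] also requires the closing edge from the last entry of x to the
   first one; tuples are labelled, so a cycle is counted once for each starting
   point and orientation. *)
Definition ncycles (e : rel 'rV[F]_d) (E : {set 'rV[F]_d}) (n : nat) : nat :=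
  #|[set x : n.-tuple 'rV[F]_d | [&& all [in E] x, uniq x & cycle e x]]|.

Definition Ndist (E : {set 'rV[F]_d}) t n : nat := ncycles (dist_rel t) E n.
Definition Nprod (E : {set 'rV[F]_d}) t n : nat := ncycles (prod_rel t) E n.

End FiniteFieldGraphs.

Section Constants.
Variable R : realType.
Implicit Types (q d n : nat) (delta : R).

(* The exponent gain: n = 2k or n = 2k + 1 with k = n./2; for 4 <= n both
   denominators are positive. *)
Definition gain n : R :=
  let k : R := (n./2)%:R in
  if odd n then (2 * k - 3) / (2 * k - 1) else (k - 2) / (k - 1).

Definition eps n delta : R := 1 - gain n + delta.

Definition bigK n : R :=
  if n == 4%N then 48
  else 36 + 80 * 6 ^+ (n./2 - 2)%N + 12 * (n./2)%:R.

(* Adding 3 before subtracting n keeps the truncated subtraction exact when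
   4 <= n, including at n = 4. *)
Definition smallc n : R :=
  (n.-1)%:R ^+ (n - 3)%N * 2 ^+ ('C(n.-1, 2) + 3 - n)%N.

Definition size_threshold q d n delta : R :=
  q%:R `^ (2^-1 * (d%:R + 2 - gain n + delta)).

Definition rel_error q d n delta : R :=
  bigK n * q%:R `^ (- ((n%:R / 2 - 1) * delta))
  + 2 * n%:R * q%:R `^ (- (2 / (n%:R - 1)))
  + smallc n * q%:R `^ (- ((d%:R - 3) / 2) - eps n delta).

End Constants.

(* Main.v *)
Require Import Defs.
From HB Require Import structures.
From mathcomp Require Import all_boot all_order all_algebra all_fingroup all_field.
From mathcomp Require Import complex reals exp.
From mathcomp Require Import zify ring lra.

Set Implicit Arguments.
Unset Strict Implicit.
Unset Printing Implicit Defensive.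

Import Order.TTheory GRing.Theory Num.Theory.
Local Open Scope ring_scope.

(** Let q = #|F|, let A be the adjacency matrix of the graph on E, and S = #|E| / q.
Then A = q^-1 J + R, where R has operator norm at most beta = 2 q^((d-1)/2). Hence
tr (A^n), the number of closed walks of length n, is S^n up to
beta^(n-2) |R|_HS^2 and O(S^(n-1) beta); the size condition on E makes the first
term at most a constant times q^(-(n/2-1) delta) S^n, and the second one smaller by
a power of q. A closed walk with a repeated vertex splits into two closed walks at
that vertex, so such walks are few; in the plane this uses that two distinct
vertices have at most two common neighbours.

The eigenvalues of R for the distance graph are, up to powers of a Gauss sum,
Kloosterman sums (d even) or Salie sums (d odd); the latter reduce to counting
square roots. For the former Weil's bound is obtained from an elementary
Stepanov-type count of the points of trace c over an extension of even degree,
which bounds the sum over F_(q^(2m)) by O(q^(m+1)), together with the relation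
S_(2m) = 2 q^m - S_m^2, which removes the constant. *)

(** * Stepanov's polynomial *)

(** The constant 2 in beta matters. The leading error is 3 * 2^(n-2) times the first power of q,
    while [bigK] grows only like 6^(n/2); any constant above sqrt 6 in place of 2 would fail for
    large n. A bound O(q^(1/2)) for Kloosterman sums is therefore not enough, and the doubling
    relation has to sharpen it. The other obstacle is d = 2. There the size condition allows S < q
    as soon as n >= 5, and operator norms bound the degenerate walks only by about q / S relative to
    the main term. For n = 4 the condition asks for more than q^2 points, so nothing has to be
    shown. For n >= 7 the third error term is at least 1, so only an upper bound is at stake, and
    degenerate walks help there. Only n = 5 and n = 6 require the count of common neighbours. *)

Lemma sum_monic_staircase_neq0 (F : fieldType) (n c : nat) (b : 'I_n -> {poly F})
    (v : 'rV[F]_n) :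
  (forall r, b r \is monic) -> (forall r, size (b r) = (r + c).+1) ->
  v != 0 -> \sum_r v 0 r *: b r != 0.
Proof.
move=> bm bs vn0; apply/eqP => sum0.
have /rV0Pn[r0 vr0] := vn0.
case: (@arg_maxnP _ r0 (fun r => v 0 r != 0) (fun r : 'I_n => r : nat) vr0) => r vr rmax.
have /eqP := congr1 (fun p : {poly F} => p`_(r + c)) sum0.
rewrite coef0 coef_sum (bigD1 r) //= big1 ?addr0 => [|j jr].
  have := monicP (bm r); rewrite /lead_coef bs /= coefZ => ->.
  by rewrite mulr1 (negPf vr).
rewrite coefZ; have [->|vj] := eqVneq (v 0 j) 0; first by rewrite mul0r.
rewrite nth_default ?mulr0 // bs.
have jler : (j <= r)%N := rmax j vj.
have jner : (j != r :> nat) by [].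
by lia.
Qed.

Lemma dependent_polys (F : fieldType) (n D : nat) (c : 'I_n -> {poly F}) :
  (D < n)%N -> (forall r, size (c r) <= D)%N ->
  exists2 v : 'rV[F]_n, v != 0 & \sum_r v 0 r *: c r = 0.
Proof.
move=> Dn cs; pose B : 'M[F]_(n, D) := \matrix_(r, i) (c r)`_i.
have kn0 : kermx B != 0.
  by rewrite -mxrank_eq0 mxrank_ker subn_eq0 -ltnNge (leq_ltn_trans (rank_leq_col B)).
exists (nz_row (kermx B)); first by rewrite nz_row_eq0.
have /sub_kermxP vB : (nz_row (kermx B) <= kermx B)%MS := nz_row_sub _.
apply/polyP => i; rewrite coef0 coef_sum.
have [iD|Di] := ltnP i D; last first.
  by rewrite big1 // => r _; rewrite coefZ nth_default ?mulr0 // (leq_trans (cs r)).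
have /matrixP/(_ 0 (Ordinal iD)) := vB.
rewrite !mxE => vB0; rewrite -[RHS]vB0.
by apply: eq_bigr => r _; rewrite coefZ [B _ _]mxE.
Qed.

Lemma pchar_nat_card (F : finFieldType) (L : fieldType) (f : {rmorphism F -> L}) k :
  [pchar L].-nat (#|F| ^ k)%N.
Proof.
have [p pp pF] := finPcharP F.
have pL : p \in [pchar L] by rewrite (fmorph_pchar f).
have [e qe] : exists e, #|F| = (p ^ e)%N.
  by exists (logn p #|F|); exact: (card_pprimeChar pF).
by rewrite (eq_pnat _ (pcharf_eq pL)) qe -expnM pnatX pnat_id.
Qed.

Section Stepanov.
Variables (F : finFieldType) (a c : F) (m' : nat).
Let q := #|F|.
Let M := (q ^ m')%N.
Let s := (M * q)%N.
(** The range of the top digit [ii r]. [M + 2] is the least uniform choice for which the [s * A]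
    polynomials [cpol r] outnumber their possible coefficients; [M + 1] fails when M = 1. *)
Let A := (M + 2)%N.

(* The factor [X^M] clears the poles of the trace [\sum_i X^(q^i) + a X^(-q^i)]
   of [x + a / x]. *)
Definition trace_numerator : {poly F} :=
  \sum_(i < m'.+1) ('X^(M + q ^ i) + a *: 'X^(M - q ^ i)).
Let H := trace_numerator.

Let q_gt1 : (1 < q)%N. Proof. exact: finNzRing_gt1. Qed.
Let M_gt0 : (0 < M)%N. Proof. by rewrite expn_gt0 (ltnW q_gt1). Qed.

Lemma size_trace_numerator : size H = (2 * M).+1 /\ H \is monic.
Proof.
have bnd : (size (\sum_(i < m') ('X^(M + q ^ i) + a *: 'X^(M - q ^ i)) +
                  a *: 'X^(M - q ^ m') : {poly F})%R < (2 * M).+1)%N.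
  rewrite ltnS (leq_trans (size_polyD _ _)) // geq_max; apply/andP; split; last first.
    by rewrite (leq_trans (size_scale_leq _ _)) // size_polyXn; lia.
  apply: (leq_trans (size_sum _ _ _)); apply/bigmax_leqP => i _.
  have lti : (q ^ i < M)%N by rewrite ltn_exp2l.
  rewrite (leq_trans (size_polyD _ _)) // geq_max size_polyXn.
  rewrite (leq_trans (size_scale_leq _ _)) ?size_polyXn; lia.
have -> : H = 'X^(2 * M) + (\sum_(i < m') ('X^(M + q ^ i) + a *: 'X^(M - q ^ i)) +
                  a *: 'X^(M - q ^ m')).
  by rewrite /H /trace_numerator big_ord_recr /= -/M addnn mul2n addrCA.
have sX : size ('X^(2 * M) : {poly F}) = (2 * M).+1 by rewrite size_polyXn.
by split; rewrite ?monicE (size_polyDl, lead_coefDl) ?sX ?lead_coefXn.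
Qed.

Let monH : H \is monic. Proof. by case: size_trace_numerator. Qed.
Let sizeH : size H = (2 * M).+1. Proof. by case: size_trace_numerator. Qed.

Let li (r : nat) := (r %% M)%N.
Let ii (r : nat) := (r %/ M %/ q)%N.
Let ji (r : nat) := (r %/ M %% q)%N.

(* The polynomials [bpol r] have consecutive degrees, so no nontrivial combination
   of them vanishes. Where [x^(s^2) = x] and the trace [h] satisfies
   [h^s = c - h], the s-th power of [bpol r] agrees up to a power of [x] with
   [cpol r], whose degree is so small that the [cpol r] are dependent. *)
Let bpol (r : nat) : {poly F} :=
  'X^(li r + s * ii r + M * (q.-1 - ji r)) * H ^+ ji r.
Let cpol (r : nat) : {poly F} :=
  'X^(s * li r + ii r + M * (q.-1 - ji r)) * (c *: 'X^M - H) ^+ ji r.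

Let ji_le r : (ji r <= q.-1)%N.
Proof. by have := ltn_pmod (r %/ M) (ltnW q_gt1); rewrite -/(ji r); lia. Qed.

Let bpol_monic r : bpol r \is monic.
Proof. by rewrite monicMl ?monicXn // monic_exp. Qed.

Let size_bpol r : size (bpol r) = (r + M * q.-1).+1.
Proof.
rewrite size_monicM ?monicXn ?monic_neq0 ?monic_exp // size_polyXn.
have -> : size (H ^+ ji r) = (2 * M * ji r).+1.
  have := size_exp H (ji r); rewrite sizeH /= => <-.
  by rewrite prednK // size_poly_gt0 monic_neq0 // monic_exp.
have e1 := divn_eq r M; have e2 := divn_eq (r %/ M) q.
have := ji_le r; rewrite -/(li r) -/(ii r) -/(ji r) in e1 e2 *.
rewrite /s; move: (li r) (ii r) (ji r) e1 e2 => l i j e1 e2 jq.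
rewrite addSn addnS /=; congr _.+1.
rewrite {}e2 in e1; rewrite e1; nia.
Qed.

Let size_cpol r : (r < s * A)%N ->
  (size (cpol r) <= s * M.-1 + A.-1 + 2 * M * q.-1 + 1)%N.
Proof.
move=> rlt; apply: (leq_trans (size_polyMleq _ _)); rewrite size_polyXn addSn /=.
have sD : (size (c *: 'X^M - H)%R <= (2 * M).+1)%N.
  rewrite (leq_trans (size_polyD _ _)) // geq_max size_polyN sizeH leqnn andbT.
  by rewrite (leq_trans (size_scale_leq _ _)) // size_polyXn; lia.
have sE : (size ((c *: 'X^M - H) ^+ ji r)%R <= (2 * M * ji r).+1)%N.
  apply: (leq_trans (size_poly_exp_leq _ _)); rewrite ltnS.
  rewrite leq_mul2r; apply/orP; right; lia.
have lM : (li r <= M.-1)%N by have := ltn_pmod r M_gt0; rewrite -/(li r); lia.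
have iA : (ii r <= A.-1)%N.
  have : (ii r < A)%N by rewrite /ii -divnMA ltn_divLR 1?mulnC // muln_gt0 M_gt0 ltnW.
  lia.
have jq := ji_le r.
move: (li r) (ii r) (ji r) lM iA jq sE => l i j lM iA jq sE.
apply: (leq_trans (leq_add (leqnn _) sE)); rewrite addnS addn1 ltnS.
have : (s * l <= s * M.-1)%N by rewrite leq_mul2l lM orbT.
have : (M * (q.-1 - j) + 2 * M * j <= 2 * M * q.-1)%N by nia.
lia.
Qed.

(** The coefficients of the dependence lie in F, hence are fixed by the s-th power, so the relation
    among the [cpol r] becomes the vanishing of the s-th power of the same combination of the
    [bpol r]. The degree exceeds s M = s^2 / q, the average number of points of a given trace, by
    less than 3 s. With leading constant 1, upper bounds for all c also yield lower bounds by
    summation. *)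
Lemma stepanov_poly :
  exists2 g : {poly F}, g != 0 /\ (size g <= s * M + 3 * s)%N &
  forall (L : fieldType) (f : {rmorphism F -> L}) (x : L),
    x != 0 -> x ^+ (s * s) = x ->
    (\sum_(i < m'.+1) (x ^+ (q ^ i) + f a / x ^+ (q ^ i))) ^+ s =
      f c - \sum_(i < m'.+1) (x ^+ (q ^ i) + f a / x ^+ (q ^ i)) ->
    root (map_poly f g) x.
Proof.
have sA : (s * M.-1 + A.-1 + 2 * M * q.-1 + 1 < s * A)%N.
  rewrite /A /s.
  have -> : M = M.-1.+1 by lia.
  have -> : q = q.-1.-1.+2 by lia.
  move: M.-1 q.-1.-1 => x y /=; nia.
have [v vn0 vc] := dependent_polys (c := fun r : 'I_(s * A) => cpol r) sA
  (fun r => size_cpol (ltn_ord r)).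
exists (\sum_r v 0 r *: bpol (r : 'I_(s * A))).
  split.
    by apply: (sum_monic_staircase_neq0 (c := (M * q.-1)%N)) => // r; rewrite size_bpol.
  apply: (leq_trans (size_sum _ _ _)); apply/bigmax_leqP => r _.
  apply: (leq_trans (size_scale_leq _ _)); rewrite size_bpol.
  have : (M * q.-1 + M = s)%N by rewrite addnC -mulnS prednK // ltnW.
  have : (s * A = s * M + 2 * s)%N by rewrite mulnDr [(s * 2)%N]mulnC.
  case: r => r /= ; lia.
move=> L f x xn0 xss; set h := \sum_(i < _) _ => hs.
have Hx : (map_poly f H).[x] = x ^+ M * h.
  rewrite /H /trace_numerator rmorph_sum horner_sum mulr_sumr; apply: eq_bigr => i _.
  have iM : (q ^ i <= M)%N by rewrite leq_exp2l // -ltnS.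
  rewrite rmorphD /= map_polyZ /= !map_polyXn hornerD hornerZ !hornerXn mulrDr exprD.
  by congr (_ + _); rewrite mulrCA -[in RHS](subnK iM) exprD mulfK // expf_neq0.
have fr (u w : L) : (u + w) ^+ s = u ^+ s + w ^+ s.
  by rewrite exprDn_pchar // /s /M -expnSr (pchar_nat_card f).
have frs (I : finType) (G : I -> L) : (\sum_i G i) ^+ s = \sum_i G i ^+ s.
  elim/big_rec2: _ => [|i y z _ <-]; last by rewrite fr.
  by rewrite expr0n muln_eq0 !gtn_eqF // ltnW.
have vs (y : F) : f y ^+ s = f y.
  rewrite /s /M -expnSr -rmorphXn; congr (f _).
  elim: (m'.+1) => [|k IH]; first by rewrite expr1.
  by rewrite expnSr exprM IH expf_card.
rewrite /root rmorph_sum horner_sum.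
have : \sum_(r < s * A) (map_poly f (v 0 r *: cpol r)).[x] = 0.
  by rewrite -horner_sum -rmorph_sum vc rmorph0 horner0.
have key (r : 'I_(s * A)) : (map_poly f (v 0 r *: cpol r)).[x] * x ^+ (s * (M * q.-1)) =
    (map_poly f (v 0 r *: bpol r)).[x] ^+ s * x ^+ (M * q.-1).
  rewrite /cpol /bpol !map_polyZ !hornerZ !rmorphM !rmorphXn /= !map_polyX.
  rewrite rmorphB /= map_polyZ /= map_polyXn !hornerM !horner_exp hornerX hornerD.
  rewrite hornerN hornerZ hornerXn Hx.
  have -> : f c * x ^+ M - x ^+ M * h = x ^+ M * h ^+ s by rewrite hs; ring.
  rewrite [in RHS]exprMn vs -!mulrA; congr (_ * _).
  have := ji_le r; move: (li r) (ii r) (ji r) => l i j jq.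
  rewrite !exprMn -!exprM !exprD.
  have -> : x ^+ ((l + s * i + M * (q.-1 - j)) * s) = x ^+ (s * l) * x ^+ i * x ^+ (s * (M * (q.-1 - j))).
    have -> : ((l + s * i + M * (q.-1 - j)) * s =
               s * l + s * s * i + s * (M * (q.-1 - j)))%N by ring.
    by rewrite !exprD [x ^+ (s * s * i)]exprM xss.
  rewrite [(j * s)%N]mulnC -(subnK jq).
  rewrite !mulnDr !exprD.
  have -> : (M * j * s = s * (M * j))%N by rewrite mulnC.
  rewrite addnK; ring.
move=> /(congr1 (fun z => z * x ^+ (s * (M * q.-1)))).
rewrite mul0r mulr_suml (eq_bigr _ (fun r _ => key r)) -mulr_suml -frs => /eqP.
rewrite mulf_eq0 expf_eq0 => /orP[/andP[_]//|].
by rewrite expf_eq0 (negPf xn0) andbF.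
Qed.
End Stepanov.

(** The whole tower lives in one splitting field of ['X^(q ^ (2 ^ J)) - 'X], each subfield being a
    set of Frobenius-fixed points. The polynomial has derivative -1, hence distinct roots, and the
    earlier ones divide it, so they also split into distinct factors. *)
Lemma exists_extension (F : finFieldType) (J : nat) :
  exists (L : finFieldType) (f : {rmorphism F -> L}), forall j, (j <= J)%N ->
    #|[set x : L | x ^+ (#|F| ^ (2 ^ j)) == x]| = (#|F| ^ (2 ^ j))%N.
Proof.
set q := #|F|; have q1 : (1 < q)%N := finNzRing_gt1 F.
pose P (K : fieldType) j : {poly K} := 'X^(q ^ (2 ^ j)) - 'X.
have qj1 j : (1 < q ^ (2 ^ j))%N by rewrite (leq_trans q1) // -{1}[q]expn1 leq_exp2l // expn_gt0.
have sP (K : fieldType) j : size (P K j) = (q ^ (2 ^ j)).+1.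
  by rewrite size_polyDl ?size_polyXn // size_polyN size_polyX ltnS.
have P0 (K : fieldType) j : P K j != 0 by rewrite -size_poly_gt0 sP.
have [L [zs Dzs _]] := FinSplittingFieldFor (P0 F J).
exists (FinFieldExtType L), (in_alg L) => j jJ.
have PJ : map_poly (in_alg L) (P F J) = P L J by rewrite rmorphB /= map_polyXn map_polyX.
rewrite PJ in Dzs.
have pn k : [pchar L].-nat (q ^ k)%N := pchar_nat_card (in_alg L) k.
have sepJ : separable_poly (P L J).
  rewrite unlock /P derivB derivXn derivX.
  have -> : ('X^((q ^ 2 ^ J).-1) *+ (q ^ 2 ^ J) : {poly L}) = 0.
    rewrite -[_ *+ _]mulr_natr; apply/eqP; rewrite mulf_eq0; apply/orP; right.
    have [p pp pF] := finPcharP F.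
    have pL : p \in [pchar L] by rewrite (fmorph_pchar (in_alg L)).
    have : (p %| q ^ 2 ^ J)%N.
      have := pn (2 ^ J)%N; rewrite (eq_pnat _ (pcharf_eq pL)) => /p_natP[k kE].
      by rewrite kE; case: k kE => [kE|k _]; [have := qj1 J; rewrite kE|rewrite dvdn_exp].
    by rewrite (dvdn_pcharf pL) -polyC_natr => /eqP ->.
  by rewrite sub0r -[X in coprimep _ X]scaleN1r coprimepZr ?oppr_eq0 ?oner_eq0 // coprimep1.
have uzs : uniq zs by rewrite -separable_prod_XsubC -(eqp_separable Dzs).
have dv : P L j %| P L J.
  elim: J jJ {Dzs sepJ uzs PJ} => [|J IH]; first by rewrite leqn0 => /eqP->.
  rewrite leq_eqVlt ltnS => /orP[/eqP->//|/IH jJ]; apply: (dvdp_trans jJ).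
  (* With Q = q^(2^J), X^(Q^2) - X = (X^Q - X)^Q + (X^Q - X). *)
  have -> : P L J.+1 = P L J ^+ (q ^ 2 ^ J) + P L J.
    have pnP : [pchar {poly L}].-nat (q ^ 2 ^ J)%N.
      by rewrite (eq_pnat _ (pchar_poly _)).
    rewrite {2}/P (exprDn_pchar _ _ pnP) /P -exprM -expnD addnn -mul2n -expnS.
    have -> : (- 'X : {poly L}) ^+ (q ^ 2 ^ J) = - 'X^(q ^ 2 ^ J).
      apply/eqP; rewrite -addr_eq0 -(exprDn_pchar _ _ pnP) addNr expr0n.
      by rewrite gtn_eqF // ltnW.
    by rewrite addrA subrK.
  by apply: dvdp_add => //; rewrite -[X in X %| _]expr1 dvdp_exp2l // ltnW.
have [m Dm] : {m | P L j %= \prod_(z <- mask m zs) ('X - z%:P)}.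
  by apply: dvdp_prod_XsubC; rewrite -(eqp_dvdr _ Dzs).
have := eqp_size Dm; rewrite sP size_prod_XsubC => -[sz]; rewrite [RHS]sz.
have um : uniq (mask m zs) by rewrite mask_uniq.
apply: etrans (@card_uniqP (FinFieldExtType L) _ um); apply: eq_card => x; rewrite inE.
have := eqp_root Dm x; rewrite root_prod_XsubC => <-.
by rewrite /root /P !hornerE (subr_eq0 (x ^+ _) x).
Qed.

(** * Additive characters and Kloosterman sums *)

Definition additive_char (F : finFieldType) (C : numClosedFieldType) (chi : F -> C) :=
  [/\ forall x y, chi (x + y) = chi x * chi y, forall x, `|chi x| = 1
    & exists x, chi x != 1].

Section AdditiveChar.
Variables (F : finFieldType) (C : numClosedFieldType) (chi : F -> C).
Hypothesis chiP : additive_char chi.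

Lemma addcharD x y : chi (x + y) = chi x * chi y. Proof. by case: chiP. Qed.
Lemma addchar_norm x : `|chi x| = 1. Proof. by case: chiP. Qed.
Lemma addchar_neq0 x : chi x != 0. Proof. by rewrite -normr_eq0 addchar_norm oner_eq0. Qed.
Lemma addchar0 : chi 0 = 1.
Proof. by apply: (mulfI (addchar_neq0 0)); rewrite -addcharD addr0 mulr1. Qed.
Lemma addcharN x : chi (- x) = (chi x)^*.
Proof.
apply: (mulfI (addchar_neq0 x)); rewrite -addcharD subrr addchar0.
by rewrite -normCK addchar_norm expr1n.
Qed.

(* Translating by an element where the character is not [1] rescales the sum. *)
Lemma sum_char_eq0 (I : finType) (A : {set I}) (g : I -> C) (z : C) (sh : I -> I) :
  z != 1 -> injective sh -> (forall i, (sh i \in A) = (i \in A)) ->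
  (forall i, i \in A -> g (sh i) = z * g i) -> \sum_(i in A) g i = 0.
Proof.
move=> z1 shI shA gsh; set T := LHS.
suff: (1 - z) * T = 0 by move/eqP; rewrite mulf_eq0 subr_eq0 eq_sym (negPf z1) => /eqP.
rewrite mulrBl mul1r {2}/T mulr_sumr -(eq_bigr _ gsh) {1}/T (reindex_inj shI) /=.
by rewrite (eq_bigl _ _ shA) subrr.
Qed.

Lemma sum_char : \sum_x chi x = 0.
Proof.
have [x0 x01] : exists x, chi x != 1 by case: chiP.
have -> : \sum_x chi x = \sum_(x in [set: F]) chi x by apply: eq_bigl => x; rewrite inE.
apply: (sum_char_eq0 x01 (addrI x0)) => [i|i _]; first by rewrite !inE.
exact: addcharD.
Qed.

Lemma sum_charM y : \sum_x chi (x * y) = #|F|%:R *+ (y == 0).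
Proof.
have [->|y0] := eqVneq y 0.
  by rewrite (eq_bigr (fun _ => 1)) ?sumr_const // => x _; rewrite mulr0 addchar0.
by rewrite mulr0n -[RHS]sum_char [RHS](reindex_inj (mulIf y0)).
Qed.
End AdditiveChar.

(** * Kloosterman sums over subfields of a fixed extension *)

Section Extension.
Variables (F : finFieldType) (C : numClosedFieldType) (chi : F -> C).
Hypothesis chiP : additive_char chi.
Variables (L : finFieldType) (f : {rmorphism F -> L}) (a0 : F).
Hypothesis a0_neq0 : a0 != 0.
Let q := #|F|.
Let a := f a0.

Definition frob_fixed m := [set x : L | x ^+ (#|F| ^ m) == x].
Definition frob_trace m (x : L) := \sum_(i < m) x ^+ (#|F| ^ i).
Local Notation Kset := frob_fixed.
Local Notation tr := frob_trace.
(** [chi] carried along [f], extended by zero outside the image. It is used as a character only on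
    [Kset 1], which is the image and contains all traces. *)
Definition lift_char (y : L) : C := \sum_c chi c *+ (y == f c).
(** If [Kset m] has q^m elements it is the subfield of degree m over F, and this is its Kloosterman
    sum for [chi] composed with the trace. *)
Definition ext_kloosterman m :=
  \sum_(x in Kset m | x != 0) lift_char (tr m (x + f a0 / x)).
Local Notation S := ext_kloosterman.

Let q_gt1 : (1 < q)%N. Proof. exact: finNzRing_gt1. Qed.
Let qm_gt0 m : (0 < q ^ m)%N. Proof. by rewrite expn_gt0 (ltnW q_gt1). Qed.

Let frobD m (x y : L) : (x + y) ^+ (q ^ m) = x ^+ (q ^ m) + y ^+ (q ^ m).
Proof. by rewrite exprDn_pchar // (pchar_nat_card f). Qed.

Let frobN m (x : L) : (- x) ^+ (q ^ m) = - x ^+ (q ^ m).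
Proof. by apply/eqP; rewrite -addr_eq0 -frobD addNr expr0n gtn_eqF. Qed.

Let KD m x y : x \in Kset m -> y \in Kset m -> x + y \in Kset m.
Proof. by rewrite !inE frobD => /eqP-> /eqP->. Qed.
Let KN m x : x \in Kset m -> - x \in Kset m.
Proof. by rewrite !inE frobN => /eqP->. Qed.
Let KM m x y : x \in Kset m -> y \in Kset m -> x * y \in Kset m.
Proof. by rewrite !inE exprMn => /eqP-> /eqP->. Qed.
Let KV m x : x \in Kset m -> x^-1 \in Kset m.
Proof. by rewrite !inE exprVn => /eqP->. Qed.

Let fK m c : f c \in Kset m.
Proof.
rewrite inE -rmorphXn; apply/eqP; congr (f _).
by elim: m => [|m IH]; rewrite ?expr1 // expnSr exprM IH expf_card.
Qed.
Let aK m : a \in Kset m. Proof. exact: fK. Qed.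
Let a_neq0 : a != 0. Proof. by rewrite fmorph_eq0. Qed.

Let trD m x y : tr m (x + y) = tr m x + tr m y.
Proof. by rewrite /tr -big_split; apply: eq_bigr => i _; rewrite frobD. Qed.

Let tr_K1 m x : x \in Kset m -> tr m x \in Kset 1.
Proof.
move=> xK; have frs : (tr m x) ^+ q = \sum_(i < m) x ^+ (q ^ i.+1).
  rewrite /tr; elim/big_rec2: _ => [|i y z _ <-]; first by rewrite expr0n gtn_eqF // ltnW.
  by have := frobD 1; rewrite !expn1 => ->; rewrite -exprM -expnSr.
rewrite inE expn1 frs /tr; case: m xK {frs} => [|m] xK; first by rewrite !big_ord0.
rewrite big_ord_recr [X in _ == X]big_ord_recl /= addrC.
by move: xK; rewrite inE expr1 => /eqP->.
Qed.

Let K1_image y : y \in Kset 1 -> exists c, y = f c.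
Proof.
move=> yK; have : y \in [set f c | c in F]; last by case/imsetP => c _ ->; exists c.
suff /eqP-> : [set f c | c in F] == Kset 1 by [].
rewrite eqEcard; apply/andP; split; first by apply/subsetP => _ /imsetP[c _ ->].
rewrite (card_imset _ (fmorph_inj f)) cardE /enum_mem.
have p0 : 'X^q - 'X != 0 :> {poly L}.
  by rewrite -size_poly_gt0 size_polyDl ?size_polyXn // size_polyN size_polyX ltnS.
have := @max_poly_roots _ _ (enum (Kset 1)) p0; rewrite -cardE.
rewrite size_polyDl ?size_polyXn ?size_polyN ?size_polyX // ltnS; apply.
  by apply/allP => z; rewrite mem_enum inE expn1 /root !hornerE subr_eq0.
exact: enum_uniq.
Qed.

Lemma lift_charE c : lift_char (f c) = chi c.
Proof.
rewrite /lift_char (bigD1 c) //= eqxx big1 ?addr0 // => i ic.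
by rewrite (inj_eq (fmorph_inj f)) eq_sym (negPf ic).
Qed.

Let lift_charD y z : y \in Kset 1 -> z \in Kset 1 ->
  lift_char (y + z) = lift_char y * lift_char z.
Proof.
move=> /K1_image[c ->] /K1_image[e ->].
by rewrite -rmorphD !lift_charE addcharD.
Qed.

(** A fibre of the trace of degree m + 1 consists of roots of a polynomial of degree q^m; if one
    value were missed, the other q - 1 fibres would be too small to hold q^(m+1) elements. *)
Let tr_surj m c : #|Kset m| = (q ^ m)%N -> exists2 x, x \in Kset m & tr m x = f c.
Proof.
case: m => [|m] cK.
  (* As q^0 = 1, [Kset 0] is all of L, so the cardinality hypothesis is contradictory for m = 0. *)
  have : (1 < #|Kset 0|)%N.
    apply: (@leq_trans #|[set (0 : L); 1]|).
      by rewrite cards2 eq_sym oner_neq0.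
    by apply: subset_leq_card; apply/subsetP => x; rewrite !inE expr1 => /orP[]/eqP->;
      rewrite eqxx.
  by rewrite cK.
case: (pickP [pred x in Kset m.+1 | tr m.+1 x == f c]) => [x /andP[xK /eqP]|no].
  by exists x.
have fib e : (#|[set x in Kset m.+1 | tr m.+1 x == f e]| <= q ^ m)%N.
  pose p : {poly L} := \sum_(i < m.+1) 'X^(q ^ i) - (f e)%:P.
  have sp : size p = (q ^ m).+1.
    rewrite /p big_ord_recr /= -addrA addrC -addrA size_polyDl size_polyXn //.
    rewrite ltnS (leq_trans (size_polyD _ _)) // geq_max; apply/andP; split.
      by rewrite size_polyN (leq_trans (size_polyC_leq1 _)).
    apply: (leq_trans (size_sum _ _ _)); apply/bigmax_leqP => i _.
    by rewrite size_polyXn ltn_exp2l.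
  have p0 : p != 0 by rewrite -size_poly_gt0 sp.
  rewrite -ltnS -sp cardE; apply: max_poly_roots => //; last exact: enum_uniq.
  apply/allP => x; rewrite mem_enum inE => /andP[_ /eqP txe].
  rewrite /root hornerD hornerN hornerC horner_sum subr_eq0 -txe; apply/eqP.
  by apply: eq_bigr => i _; rewrite hornerXn.
have : (q ^ m.+1 <= \sum_(e | e != c) q ^ m)%N.
  rewrite -cK -sum1_card.
  apply: (@leq_trans (\sum_(e | e != c) #|[set x in Kset m.+1 | tr m.+1 x == f e]|));
    last exact: leq_sum.
  rewrite (eq_bigr (fun e => \sum_(x in Kset m.+1 | tr m.+1 x == f e) 1)%N); last first.
    by move=> e _; rewrite sum1dep_card.
  rewrite (exchange_big_dep (mem (Kset m.+1))) /=; last by move=> ? ? _ /andP[].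
  apply: leq_sum => x xK; rewrite sum1dep_card card_gt0.
  have [e te] := K1_image (tr_K1 xK); apply/set0Pn; exists e.
  have ec : e != c by apply/eqP => ec; have := no x; rewrite /= xK te ec eqxx.
  by rewrite inE ec xK te eqxx.
rewrite sum_nat_const cardC1 -/q leqNgt expnS ltn_mul2r qm_gt0 /=.
by rewrite prednK ?leqnn // ltnW.
Qed.

Let sum_lift_tr m b : #|Kset m| = (q ^ m)%N -> b \in Kset m ->
  \sum_(x in Kset m) lift_char (tr m (x * b)) = (q ^ m)%:R *+ (b == 0).
Proof.
move=> cK bK; have [->|b0] := eqVneq b 0.
  rewrite (eq_bigr (fun _ => 1)) ?sumr_const ?cK // => x _.
  rewrite mulr0 /tr big1; first by rewrite -(rmorph0 f) lift_charE (addchar0 chiP).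
  by move=> i _; rewrite expr0n gtn_eqF.
have [c c1] : exists x, chi x != 1 by case: chiP.
have [x0 x0K tx0] := tr_surj c cK.
apply: (sum_char_eq0 c1 (addrI (x0 / b))) => [x|x xK].
  apply/idP/idP => [h|h]; last by rewrite KD ?KM ?KV.
  by rewrite -[x](addKr (x0 / b)) KD ?KN ?KM ?KV.
by rewrite mulrDl divfK // trD lift_charD ?tr_K1 ?KM // tx0 lift_charE.
Qed.


(** A pair u stands for the quadratic X^2 - u.1 X + u.2 with nonzero constant term. [split_set]
    collects its ordered pairs of roots in the middle field, [conj_set] the elements of the
    quadratic extension with trace u.1 and norm u.2. *)
Let quad_set m : {set L * L} := [set u | (u.1 \in Kset m) && (u.2 \in Kset m) && (u.2 != 0)].
Let split_set m (u : L * L) :=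
  [set w : L * L | [&& w.1 \in Kset m, w.2 \in Kset m, w.1 + w.2 == u.1 & w.1 * w.2 == u.2]].
Let conj_set m (u : L * L) :=
  [set z in Kset (2 * m) | (z + z ^+ (q ^ m) == u.1) && (z * z ^+ (q ^ m) == u.2)].

Let quad_roots (x y z w : L) : x + y = z + w -> x * y = z * w -> z = x \/ z = y.
Proof.
move=> e1 e2; have : (z - x) * (z - y) == 0.
  have -> : (z - x) * (z - y) = z ^+ 2 - z * (x + y) + x * y by ring.
  by rewrite e1 e2; apply/eqP; ring.
by rewrite mulf_eq0 !subr_eq0 => /orP[]/eqP; [left|right].
Qed.

(* The quadratic [X^2 - u.1 X + u.2] over the middle field either splits there or
   has a pair of conjugate roots, never both. *)
Let card_split_conj m u : (#|split_set m u| + #|conj_set m u| <= 2)%N.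
Proof.
have [->|/set0Pn[w0]] := eqVneq (split_set m u) set0.
  rewrite cards0 add0n; have [->|/set0Pn[z0]] := eqVneq (conj_set m u) set0.
    by rewrite cards0.
  rewrite !inE => /and3P[_ /eqP e1 /eqP e2].
  apply: (@leq_trans #|[set z0; z0 ^+ (q ^ m)]|); last by rewrite cards2; case: (_ != _).
  apply: subset_leq_card; apply/subsetP => z; rewrite !inE => /and3P[_ /eqP e3 /eqP e4].
  by case: (@quad_roots z0 (z0 ^+ (q ^ m)) z (z ^+ (q ^ m))); rewrite ?e1 ?e2 // => ->;
    rewrite eqxx ?orbT.
case: w0 => x y; rewrite !inE /= => /and4P[xK yK /eqP e1 /eqP e2].
have sp : split_set m u \subset [set (x, y); (y, x)].
  apply/subsetP => -[z w]; rewrite !inE /= => /and4P[_ _ /eqP e3 /eqP e4].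
  case: (@quad_roots x y z w); rewrite ?e1 ?e2 // => zE; rewrite zE in e3 *.
    by move: e3; rewrite -e1 => /addrI ->; rewrite eqxx.
  by move: e3; rewrite -e1 addrC => /addIr ->; rewrite eqxx orbT.
have cj : conj_set m u \subset [set z | (z == x) && (x == y)].
  apply/subsetP => z; rewrite !inE => /and3P[_ /eqP e3 /eqP e4].
  have := @quad_roots x y z (z ^+ (q ^ m)); rewrite e1 e2 e3 e4 => /(_ erefl erefl) zxy.
  have zK : z ^+ (q ^ m) = z by case: zxy => ->; apply/eqP.
  move: e3; rewrite zK -e1; case: zxy => -> e3; move/eqP: e3.
    by rewrite eqxx (inj_eq (addrI x)) => ->.
  by rewrite (inj_eq (addIr y)) => /eqP ->; rewrite eqxx.
apply: (leq_trans (leq_add (subset_leq_card sp) (subset_leq_card cj))).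
rewrite cards2 xpair_eqE [y == x]eq_sym andbb.
have [->|xy] /= := eqVneq x y.
  by rewrite (eq_card (B := [set y])) ?cards1 // => z; rewrite !inE ?eqxx andbT.
by rewrite (eq_card (B := set0)) ?cards0 // => z; rewrite !inE andbF.
Qed.

Let Kstar_card m : #|Kset m| = (q ^ m)%N -> #|[set x in Kset m | x != 0]| = (q ^ m).-1.
Proof.
move=> cK; have := cardsD1 0 (Kset m); rewrite cK inE expr0n gtn_eqF // eqxx add1n => ->/=.
by apply: eq_card => x; rewrite !inE andbC.
Qed.

Let sum_pairs m (G : L * L -> C) :
  \sum_(x in Kset m | x != 0) \sum_(y in Kset m | y != 0) G (x + y, x * y) =
  \sum_(u in quad_set m) (#|split_set m u|)%:R * G u.
Proof.
rewrite pair_big_dep /= (partition_big (fun w : L * L => (w.1 + w.2, w.1 * w.2)) (mem (quad_set m))) /=.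
  apply: eq_bigr => u uq; rewrite (eq_bigr (fun _ => G u)) => [|w /andP[_ /eqP->]//].
  rewrite sumr_const mulr_natl; congr (_ *+ _); apply: eq_card => w.
  move: uq; rewrite !inE /= => /andP[_ u0].
  rewrite unfold_in /= -pair_eqE /= /pair_eq /= !inE.
  apply/idP/idP => [/andP[/and3P[/andP[-> _] -> _] /andP[-> ->]]//|/and4P[-> -> -> e]].
  rewrite e /= !andbT; move/eqP: e => e; rewrite -e mulf_eq0 negb_or in u0.
  by rewrite u0.
move=> [x y] /= /andP[/andP[xK x0] /andP[yK y0]].
by rewrite inE /= KD ?KM // mulf_neq0.
Qed.

Let conj_in m z : z \in Kset (2 * m) ->
  (z + z ^+ (q ^ m) \in Kset m) && (z * z ^+ (q ^ m) \in Kset m).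
Proof.
rewrite !inE frobD exprMn -!exprM -expnD addnn -mul2n => /eqP ->.
by rewrite addrC mulrC !eqxx.
Qed.

Let sum_conj m (G : L * L -> C) :
  \sum_(z in Kset (2 * m) | z != 0) G (z + z ^+ (q ^ m), z * z ^+ (q ^ m)) =
  \sum_(u in quad_set m) (#|conj_set m u|)%:R * G u.
Proof.
rewrite (partition_big (fun z : L => (z + z ^+ (q ^ m), z * z ^+ (q ^ m))) (mem (quad_set m))) /=.
  apply: eq_bigr => u uq; rewrite (eq_bigr (fun _ => G u)) => [|w /andP[_ /eqP->]//].
  rewrite sumr_const mulr_natl; congr (_ *+ _); apply: eq_card => z.
  move: uq; rewrite !inE /= => /andP[_ u0].
  rewrite unfold_in /= -pair_eqE /= /pair_eq /= !inE.
  apply/idP/idP => [/andP[/andP[-> _] /andP[-> ->]]//|/and3P[-> -> e]].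
  rewrite e /= !andbT; move/eqP: e => e; rewrite -e mulf_eq0 negb_or in u0.
  by case/andP: u0.
move=> z /andP[zK z0]; have /andP[h1 h2] := conj_in zK.
by rewrite inE /= h1 h2 mulf_neq0 // expf_neq0.
Qed.

Let card_quad m : #|Kset m| = (q ^ m)%N -> #|quad_set m| = (q ^ m * (q ^ m).-1)%N.
Proof.
move=> cK; rewrite -{1}cK -(Kstar_card cK) -cardsX; apply: eq_card => u.
by rewrite !inE /= andbA.
Qed.

(** With Q = q^m, the two families have (Q - 1)^2 and Q^2 - 1 members, together 2 Q (Q - 1), twice
    the number of quadratics. The upper bound 2 is thus attained by every u, without discriminants
    and in every characteristic. *)
Let card_split_conj_eq m u : #|Kset m| = (q ^ m)%N -> #|Kset (2 * m)| = (q ^ (2 * m))%N ->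
  u \in quad_set m -> (#|split_set m u| + #|conj_set m u|)%N = 2.
Proof.
move=> cK cK2 uq.
have e1 := @sum_pairs m (fun _ => 1); have e2 := @sum_conj m (fun _ => 1).
have : \sum_(u in quad_set m) (2 - (#|split_set m u| + #|conj_set m u|))%:R = 0 :> C.
  rewrite (eq_bigr (fun u => 2%:R - (#|split_set m u|%:R * 1 + #|conj_set m u|%:R * 1)));
    last first.
    by move=> v _; rewrite natrB ?card_split_conj // natrD !mulr1.
  rewrite big_split /= sumr_const card_quad // sumrN big_split /= -e1 -e2.
  have cs k : \sum_(x in Kset k | x != 0) (1 : C) = #|[set x in Kset k | x != 0]|%:R.
    by rewrite sumr_const; congr (_ *+ _); apply: eq_card => x; rewrite unfold_in /= !inE.
  under eq_bigr do rewrite cs.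
  rewrite sumr_const cs !Kstar_card //.
  rewrite (eq_card (B := [set x in Kset m | x != 0])) => [|x];
    last by rewrite unfold_in /= !inE.
  rewrite Kstar_card // -[2 *+ _]mulr_natr -[_.-1%:R *+ _]mulr_natr -!natrM -natrD.
  apply/eqP; rewrite subr_eq0 eqr_nat; apply/eqP.
  have -> : (q ^ (2 * m) = q ^ m * q ^ m)%N by rewrite -expnD addnn mul2n.
  by have := qm_gt0 m; case: (q ^ m)%N => // k _; rewrite succnK mulSn mulnS; lia.
move/eqP; rewrite psumr_eq0 // => /allP/(_ u (mem_index_enum u)).
rewrite uq /= pnatr_eq0 subn_eq0 => h; apply/eqP.
by rewrite eqn_leq card_split_conj.
Qed.

Let trS m x : tr (2 * m) x = tr m (x + x ^+ (q ^ m)).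
Proof.
rewrite trD mul2n -addnn /tr big_split_ord /=; congr (_ + _).
by apply: eq_bigr => i _; rewrite -exprM -expnD.
Qed.

Let norm_trace x y : x != 0 -> y != 0 ->
  x + a / x + (y + a / y) = (x + y) * (1 + a / (x * y)).
Proof. by move=> x0 y0; field; rewrite x0 y0. Qed.

(** Since x + a/x + y + a/y = (x + y)(1 + a/(xy)) depends only on sum and product, both [S m ^+ 2]
    and [S (2 * m)] are sums of the same function over quadratics, weighted by the numbers of split
    and conjugate roots. The weights add up to 2, and the sum over u.1 vanishes unless u.2 = -a. *)
Lemma ext_kloosterman_double m : #|Kset m| = (q ^ m)%N -> #|Kset (2 * m)| = (q ^ (2 * m))%N ->
  S (2 * m) = 2 * (q ^ m)%:R - S m ^+ 2.
Proof.
move=> cK cK2; pose G (u : L * L) := lift_char (tr m (u.1 * (1 + a / u.2))).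
have inK x : x \in Kset m -> tr m (x + a / x) \in Kset 1.
  by move=> xK; rewrite tr_K1 // KD // KM ?KV // aK.
have S1 : S m ^+ 2 = \sum_(u in quad_set m) #|split_set m u|%:R * G u.
  rewrite -sum_pairs expr2 /S mulr_suml; apply: eq_bigr => x /andP[xK x0].
  rewrite mulr_sumr; apply: eq_bigr => y /andP[yK y0].
  by rewrite -lift_charD ?inK // -trD norm_trace.
have S2 : S (2 * m) = \sum_(u in quad_set m) #|conj_set m u|%:R * G u.
  rewrite -sum_conj; apply: eq_bigr => z /andP[zK z0].
  rewrite trS /G /= -norm_trace ?expf_neq0 //; congr (lift_char (tr m (_ + _))).
  rewrite frobD exprMn exprVn; congr (_ + _ / _).
  by apply/eqP; have := aK m; rewrite inE.
have : S m ^+ 2 + S (2 * m) = 2 * (q ^ m)%:R.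
  rewrite S1 S2 -big_split /= (eq_bigr (fun u => 2 * G u)); last first.
    by move=> u uq; rewrite -mulrDl -natrD card_split_conj_eq.
  rewrite -mulr_sumr; congr (_ * _).
  rewrite (eq_bigl (fun u : L * L => (u.1 \in Kset m) && ((u.2 \in Kset m) && (u.2 != 0))));
    last first.
    by move=> u; rewrite inE andbA.
  rewrite -(pair_big (mem (Kset m)) (fun y => (y \in Kset m) && (y != 0))
     (fun x y => lift_char (tr m (x * (1 + a / y))))) /= exchange_big /=.
  rewrite (eq_bigr (fun y => (q ^ m)%:R *+ (y == - a))); last first.
    move=> y /andP[yK y0]; rewrite sum_lift_tr //; last first.
      by rewrite KD ?KM ?KV ?aK // -(rmorph1 f) fK.
    by rewrite -[in RHS]addr_eq0 -(inj_eq (mulIf y0)) mul0r mulrDl mul1r divfK.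
  rewrite (bigD1 (- a)) /=; last by rewrite KN ?aK // oppr_eq0.
  by rewrite eqxx big1 ?addr0 // => y /andP[_ /negPf ->].
by move=> <-; ring.
Qed.

(** Stepanov's polynomial bounds every N c by B, while the N c add up to s^2 - 1; hence the deficits
    B - N c have total only 3 q^(m+2) + 1. *)
Lemma ext_kloosterman_bound m : #|Kset m.+1| = (q ^ m.+1)%N ->
  #|Kset (2 * m.+1)| = (q ^ (2 * m.+1))%N ->
  `|S (2 * m.+1)| <= (3 * q ^ m.+2 + 1)%:R.
Proof.
move=> cK cK2; set s := (q ^ m.+1)%N.
pose N c := #|[set x in Kset (2 * m.+1) | (x != 0) && (tr (2 * m.+1) (x + a / x) == f c)]|.
pose B := (s * q ^ m + 3 * s)%N.
have NB c : (N c <= B)%N.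
  have [g [g0 sg] gr] := stepanov_poly a0 c m.
  have sE : (q ^ m * q)%N = s by rewrite -expnSr.
  rewrite -/q sE in sg gr.
  rewrite /N cardE -ltnS.
  have sg' : (size (map_poly f g) <= B)%N by rewrite size_map_poly.
  apply: (leq_trans _ (leq_trans sg' (leqnSn _))).
  apply: max_poly_roots; [by rewrite map_poly_eq0| |exact: enum_uniq].
  apply/allP => x; rewrite mem_enum !inE => /and3P[xK x0 /eqP xc].
  apply: gr => //; first by move/eqP: xK; rewrite /s mul2n -addnn expnD.
  have trE : \sum_(i < m.+1) (x ^+ (q ^ i) + a / x ^+ (q ^ i)) = tr m.+1 (x + a / x).
    apply: eq_bigr => i _; rewrite frobD exprMn exprVn; congr (_ + _ / _).
    by apply/esym/eqP; have := aK i; rewrite inE.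
  (* For T the half trace of x + a/x, the full trace is T + T^s = c, which is the relation T^s = c -
     T required of h. *)
  rewrite -/a trE -xc trS trD addrAC subrr add0r; move: (x + a / x) => T; rewrite /tr.
  elim/big_rec2: _ => [|i y z _ <-]; first by rewrite expr0n gtn_eqF ?qm_gt0 // .
  by rewrite (frobD m.+1) -!exprM mulnC.
have SE : S (2 * m.+1) = \sum_c (N c)%:R * chi c.
  rewrite /S /lift_char exchange_big /=; apply: eq_bigr => c _.
  rewrite (eq_bigr (fun x => chi c * (tr (2 * m.+1) (x + a / x) == f c)%:R)); last first.
    by move=> x _; rewrite mulr_natr.
  rewrite -mulr_sumr mulrC; congr (_ * _).
  rewrite -natr_sum -big_mkcondr sum1dep_card; congr _%:R.
  by apply: eq_card => x; rewrite !inE andbA.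
have Ntot : (\sum_c N c = (s * s).-1)%N.
  pose Z := [set x in Kset (2 * m.+1) | x != 0].
  have <- : #|Z| = (s * s).-1 by rewrite Kstar_card // /s -expnD addnn mul2n.
  pose T x := tr (2 * m.+1) (x + a / x).
  rewrite -sum1_card (eq_bigr (fun c => \sum_(x in Z | T x == f c) 1)%N); last first.
    by move=> c _; rewrite sum1dep_card; apply: eq_card => x; rewrite !inE andbA.
  rewrite (exchange_big_dep (mem Z)) /=; last by move=> ? ? _ /andP[].
  apply: eq_bigr => x xZ; have /andP[xK x0] : (x \in Kset (2 * m.+1)) && (x != 0).
    by move: xZ; rewrite inE.
  have [e te] := K1_image (tr_K1 (KD xK (KM (aK _) (KV xK)))).
  rewrite (bigD1 e) /=; last by rewrite xZ /T te eqxx.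
  rewrite big1 // => c /andP[/andP[_ /eqP]]; rewrite /T te => /fmorph_inj ->.
  by rewrite eqxx.
(* As [chi] sums to zero, N c may be replaced by the nonnegative deficit. *)
have -> : S (2 * m.+1) = - \sum_c (B - N c)%:R * chi c.
  have -> : \sum_c (B - N c)%:R * chi c = B%:R * \sum_c chi c - S (2 * m.+1).
    by rewrite SE mulr_sumr -sumrB; apply: eq_bigr => c _; rewrite natrB // mulrBl.
  by rewrite sum_char // mulr0 sub0r opprK.
rewrite normrN (le_trans (ler_norm_sum _ _ _)) //.
rewrite (eq_bigr (fun c => (B - N c)%:R)); last first.
  by move=> c _; rewrite normrM addchar_norm // mulr1 normr_nat.
rewrite -natr_sum sumnB // Ntot sum_nat_const ler_nat /B -/q.
have -> : (q * (s * q ^ m + 3 * s) = s * s + 3 * (q ^ m.+2))%N.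
  by rewrite mulnDr mulnCA -expnS mulnCA -expnS.
lia.
Qed.

Lemma ext_kloosterman1 : S 1 = \sum_(x | x != 0) chi (x + a0 / x).
Proof.
have -> : S 1 = \sum_(y in [set f c | c in F] | y != 0) lift_char (tr 1 (y + f a0 / y)).
  apply: eq_bigl => y; congr (_ && _); apply/idP/imsetP => [/K1_image[c ->]|[c _ ->]].
    by exists c.
  exact: fK.
rewrite big_mkcondr big_imset /=; last by move=> x y _ _ /fmorph_inj.
rewrite -big_mkcondr; apply: eq_big => [x|x /andP[_ x0]]; first by rewrite fmorph_eq0.
by rewrite /tr big_ord1 expn0 expr1 -fmorph_div -rmorphD lift_charE.
Qed.
End Extension.

(** * Weil's bound for Kloosterman sums *)

Section Weil.
Variables (F : finFieldType) (C : numClosedFieldType) (chi : F -> C).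
Hypothesis chiP : additive_char chi.
Hypothesis archC : forall x : C, 0 <= x -> exists n : nat, x <= n%:R.

(** Conjugation amounts to x -> -x. Being real, the sum has its squared modulus equal to its square,
    the quantity governed by the doubling relation. *)
Lemma kloosterman_real a : (\sum_(x | x != 0) chi (x + a / x))^* = \sum_(x | x != 0) chi (x + a / x).
Proof.
rewrite rmorph_sum [RHS](reindex_inj oppr_inj) /=.
apply: eq_big => x; first by rewrite oppr_eq0.
by move=> _; rewrite -(addcharN chiP) invrN mulrN opprD.
Qed.

(* With [t_j] the square of the sum over the extension of degree [2^j], divided by
   its cardinality, [t_(j+1) = (t_j - 2)^2]: an excess of [t_0] over 4 would grow
   geometrically, against the uniform bound coming from Stepanov's polynomial. *)
Lemma kloosterman_weil a : a != 0 ->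
  `|\sum_(x | x != 0) chi (x + a / x)| ^+ 2 <= 4 * #|F|%:R.
Proof.
move=> a0; set K := \sum_(x | _) _; set q := #|F|.
have q_gt0 : 0 < q%:R :> C by rewrite ltr0n (ltnW (finNzRing_gt1 F)).
have KK : `|K| ^+ 2 = K ^+ 2 by rewrite normCK kloosterman_real expr2.
have Kre : `|K| ^+ 2 \is Num.real by rewrite realE exprn_ge0.
rewrite real_leNgt ?realM ?realn //; apply/negP => Kbig.
pose e := `|K| ^+ 2 / q%:R - 4.
have e_gt0 : 0 < e by rewrite subr_gt0 ltr_pdivlMr.
(* The bound 16 q^2 for the last term of the sequence does not depend on its index, whereas the
   excess there is at least 4^(n+1) e > n e. *)
have [n nb] : exists n : nat, 16 * q%:R ^+ 2 / e <= n%:R.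
  by apply: archC; rewrite divr_ge0 ?mulr_ge0 ?exprn_ge0 ?ltW.
have [L [f cK]] := exists_extension F n.+1.
pose S := @ext_kloosterman F C chi L f a.
pose t j := S (2 ^ j)%N ^+ 2 / (q ^ (2 ^ j))%:R.
have qj j : (q ^ (2 ^ j))%:R != 0 :> C.
  by rewrite pnatr_eq0 -lt0n expn_gt0 (ltnW (finNzRing_gt1 F)).
have t0 : t 0 = 4 + e.
  by rewrite /t /S expn0 ext_kloosterman1 // expn1 -/K -KK /e addrC subrK.
have tS j : (j <= n)%N -> t j.+1 = (t j - 2) ^+ 2.
  move=> jn; rewrite /t /S expnS ext_kloosterman_double //; last 2 first.
  - exact: (cK j (leqW jn)).
  - by rewrite -expnS; exact: (cK j.+1).
  rewrite mulnC expnM [X in _ / X]natrX -/q; have := qj j; set s := (q ^ 2 ^ j)%:R.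
  by move=> s0; field.
have tge j : (j <= n.+1)%N -> 4 + 4 ^+ j * e <= t j.
  elim: j => [|j IH] jn; first by rewrite t0 expr0 mul1r.
  rewrite tS //; set u := 4 ^+ j * e.
  have u_ge0 : 0 <= u by rewrite mulr_ge0 ?exprn_ge0 ?ltW.
  have h : 2 + u <= t j - 2.
    by rewrite lerBrDr (le_trans _ (IH (ltnW jn))) // -/u addrAC -natrD.
  apply: le_trans (_ : (2 + u) ^+ 2 <= _); last first.
    by rewrite lerXn2r ?nnegrE ?(le_trans _ h) // addr_ge0.
  have -> : (2 + u) ^+ 2 = 4 + 4 * u + u ^+ 2 by ring.
  by rewrite exprS -mulrA -/u lerDl exprn_ge0.
have tn : `|t n.+1| <= 16 * q%:R ^+ 2.
  have [m mE] : exists m, (2 ^ n = m.+1)%N by exists (2 ^ n).-1; rewrite prednK // expn_gt0.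
  rewrite /t expnS mE normrM normrX normfV normr_nat.
  have c1 := cK n (leqnSn _); have c2 := cK n.+1 (leqnn _).
  rewrite expnS mE in c2; rewrite mE in c1.
  have := ext_kloosterman_bound chiP f a0 c1 c2; rewrite -/S => Sb.
  rewrite ler_pdivrMr ?ltr0n ?expn_gt0 ?(ltnW (finNzRing_gt1 F)) //.
  apply: le_trans (_ : (3 * q ^ m.+2 + 1)%:R ^+ 2 <= _).
    by rewrite lerXn2r ?nnegrE.
  rewrite -!natrX -!natrM ler_nat -/q.
  have -> : (16 * q ^ 2 * q ^ (2 * m.+1) = (4 * q ^ m.+2) ^ 2)%N.
    by rewrite expnMn -mulnA -expnD -expnM; congr (_ * q ^ _)%N; lia.
  rewrite leq_sqr; have : (0 < q ^ m.+2)%N by rewrite expn_gt0 (ltnW (finNzRing_gt1 F)).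
  lia.
have tnp : 0 <= t n.+1.
  by apply: le_trans (tge n.+1 (leqnn _)); rewrite addr_ge0 // mulr_ge0 ?exprn_ge0 ?ltW.
have := le_trans (tge n.+1 (leqnn _)) (le_trans (real_ler_norm (ger0_real tnp)) tn).
suff h : 16 * q%:R ^+ 2 < 4 + 4 ^+ n.+1 * e by rewrite (lt_geF h).
move: nb; rewrite ler_pdivrMr // => nb.
apply: (le_lt_trans nb); rewrite ltr_wpDl // ltr_pM2r // -natrX ltr_nat.
by apply: (ltn_trans (ltn_expl n (isT : 1 < 4)%N)); rewrite ltn_exp2l.
Qed.

Lemma kloosterman_weil2 a b : a != 0 -> b != 0 ->
  `|\sum_(s | s != 0) chi (s * a + b / s)| ^+ 2 <= 4 * #|F|%:R.
Proof.
move=> a0 b0; have ab0 : a * b != 0 by rewrite mulf_neq0.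
suff -> : \sum_(s | s != 0) chi (s * a + b / s) = \sum_(x | x != 0) chi (x + a * b / x).
  exact: kloosterman_weil.
rewrite [RHS](reindex_inj (mulIf a0)) /=; apply: eq_big => s.
  by rewrite mulf_eq0 (negPf a0) orbF.
by move=> s0; congr (chi (_ + _)); field; rewrite s0 a0.
Qed.
End Weil.

(** * Existence of nontrivial additive characters *)

Lemma exists_prim_root_prime (C : numClosedFieldType) p :
  prime p -> exists w : C, p.-primitive_root w.
Proof.
move=> pp; have p_gt1 := prime_gt1 pp.
pose P : {poly C} := \poly_(i < p) 1.
have sP : size P = p by rewrite size_poly_eq // oner_neq0.
have /closed_rootP[w rw] : size P != 1%N by rewrite sP gtn_eqF.
have sumw : \sum_(i < p) w ^+ i = 0.
  move/eqP: rw; rewrite horner_poly => h; rewrite -[RHS]h; by apply: eq_bigr => i _;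
    rewrite mul1r.
have wp : w ^+ p = 1 by apply/eqP; rewrite -subr_eq0 subrX1 sumw mulr0.
have [m mw mp] := prim_order_exists (prime_gt0 pp) wp.
have : m != 1%N.
  apply/eqP => m1; rewrite m1 in mw; move: (prim_expr_order mw); rewrite expr1 => w1.
  move: sumw; rewrite (eq_bigr (fun _ => 1)) => [|i _]; last by rewrite w1 expr1n.
  by move/eqP; rewrite sumr_const card_ord pnatr_eq0 gtn_eqF // ltnW.
by move=> /(prime_nt_dvdP pp)/(_ mp) mE; exists w; rewrite -mE.
Qed.

(** A coordinate over the prime field that is nonzero at 1 takes the place of the trace, so
    nontriviality is immediate. *)
Lemma exists_additive_char (F : finFieldType) (C : numClosedFieldType) :
  exists chi : F -> C, additive_char chi.
Proof.
have [p pp pF] := finPcharP F.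
have [w wp] := exists_prim_root_prime C pp.
pose V : vectType 'F_p := pPrimeCharType pF.
pose X := vbasis {:V}.
have [i ci] : exists i, coord X i (1 : V) != 0.
  apply/existsP; apply: contraT; rewrite negb_exists => /forallP c0.
  have := coord_vbasis (memvf (1 : V)); rewrite big1 => [/eqP|i _]; last first.
    by have := c0 i; rewrite negbK => /eqP ->; rewrite scale0r.
  by rewrite oner_eq0.
pose c (x : F) : 'F_p := coord X i (x : V).
have cD x y : c (x + y) = c x + c y by rewrite /c -linearD.
exists (fun x => w ^+ (c x)); split=> [x y|x|].
- rewrite cD -exprD /=; move: (c x : nat) (c y : nat) => j k.
  by rewrite Fp_cast //; exact: (expr_mod _ (prim_expr_order wp)).
- have /eqP w1 : `|w| == 1.
    by rewrite -(pexpr_eq1 (prime_gt0 pp)) // -normrX prim_expr_order // normr1.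
  by rewrite normrX w1 expr1n.
exists (1 : F); rewrite -(prim_order_dvd wp); apply: contraNN ci => h.
have lt : (c 1%R < p)%N by rewrite -[X in (_ < X)%N](Fp_cast pp) ltn_ord.
have := gtnNdvd _ lt; case: posnP => [c0 _|c0 /(_ isT)]; last by rewrite h.
by apply/eqP/val_inj.
Qed.

Lemma odd_card_2_neq0 (F : finFieldType) : odd #|F| -> 2%:R != 0 :> F.
Proof.
move=> oF; apply/eqP => F2.
have p2 : 2%N \in [pchar F] by rewrite inE /= F2 eqxx.
have := card_pprimeChar p2; rewrite -/(#|F|) => qE.
have : odd #|F| = (logn 2 #|F| == 0)%N by rewrite {1}qE oddX orbF.
rewrite oF => /esym/eqP l0; move: (finNzRing_gt1 F); by rewrite qE l0.
Qed.

(** * Gauss and Salie sums *)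

Section Gauss.
Variables (F : finFieldType) (C : numClosedFieldType) (chi : F -> C).
Hypothesis chiP : additive_char chi.
Hypothesis oddF : odd #|F|.
Let q := #|F|.
Let two_neq0 : 2%:R != 0 :> F. Proof. exact: odd_card_2_neq0. Qed.

Let four_neq0 : 4 != 0 :> F.
Proof. by rewrite (_ : 4 = 2 * 2) ?mulf_neq0 //; ring. Qed.

Definition gauss (s : F) : C := \sum_z chi (s * z ^+ 2).
Definition nsqrt (u : F) : nat := #|[set x : F | x ^+ 2 == u]|.
(** The quadratic character, with value 0 at 0; defining it by counting square roots lets sums over
    squares be rewritten directly. *)
Definition quad_char (u : F) : C := (nsqrt u)%:R - 1.

Lemma nsqrt_le2 u : (nsqrt u <= 2)%N.
Proof.
rewrite /nsqrt; have [->|/set0Pn[x]] := eqVneq [set x : F | x ^+ 2 == u] set0.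
  by rewrite cards0.
rewrite inE => /eqP xu; apply: (@leq_trans #|[set x; - x]|); last by rewrite cards2;
  case: (_ != _).
by apply: subset_leq_card; apply/subsetP => y; rewrite !inE -xu eqf_sqr.
Qed.

Lemma sum_nsqrt (G : F -> C) : \sum_z G (z ^+ 2) = \sum_u (nsqrt u)%:R * G u.
Proof.
rewrite (partition_big (fun z : F => z ^+ 2) xpredT) //=; apply: eq_bigr => u _.
rewrite (eq_bigr (fun _ => G u)) => [|z /eqP -> //].
rewrite sumr_const mulr_natl; congr (_ *+ _); apply: eq_card => z.
by rewrite unfold_in /= inE.
Qed.

Lemma nsqrt_mul_sqr u s : s != 0 -> nsqrt (u * s ^+ 2) = nsqrt u.
Proof.
move=> s0; rewrite /nsqrt -[RHS](card_imset _ (mulIf s0)); apply: eq_card => x.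
apply/idP/imsetP => [|[y]].
  rewrite inE => /eqP h; exists (x / s); rewrite ?divfK // inE expr_div_n h mulfK //.
  by rewrite expf_neq0.
by rewrite inE => /eqP <- ->; rewrite inE exprMn.
Qed.

Lemma nsqrt_sqr s : s != 0 -> nsqrt (s ^+ 2) = 2.
Proof.
move=> s0; rewrite /nsqrt (_ : [set x | _] = [set s; - s]).
  have sNs : s != - s.
    by rewrite -subr_eq0 opprK (_ : s + s = 2%:R * s) ?mulf_neq0 // mulr_natl.
  by rewrite cards2 sNs.
by apply/setP => y; rewrite !inE eqf_sqr.
Qed.

Lemma nsqrt_nonsquare s : s != 0 -> nsqrt s != 2 -> nsqrt s = 0.
Proof.
move=> s0 n2; apply/eqP; apply: contraNT n2; rewrite cards_eq0 => /set0Pn[x].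
rewrite inE => /eqP xs; rewrite -xs nsqrt_sqr //.
by apply: contraNneq s0 => x0; rewrite -xs x0 expr0n.
Qed.

(* At most one of [u] and [s u] is a square, and on average exactly one is. *)
Lemma nsqrt_mul_nonsquare s u : s != 0 -> nsqrt s = 0 -> (nsqrt u + nsqrt (s * u)%R = 2)%N.
Proof.
move=> s0 ns.
have le2 v : (nsqrt v + nsqrt (s * v)%R <= 2)%N.
  have [->|v0] := eqVneq v 0.
    rewrite mulr0 /nsqrt (_ : [set x | _] = [set 0]) ?cards1 //.
    by apply/setP => x; rewrite !inE sqrf_eq0.
  case: (posnP (nsqrt v)) => [->|]; first by rewrite add0n nsqrt_le2.
  case: (posnP (nsqrt (s * v))) => [->|]; first by rewrite addn0 nsqrt_le2.
  rewrite !card_gt0 => /set0Pn[y]; rewrite inE => /eqP yv /set0Pn[x].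
  rewrite inE => /eqP xv; have x0 : x != 0.
    by apply: contraNneq v0 => x0; rewrite -xv x0 expr0n.
  have /eqP := ns; rewrite -(nsqrt_mul_sqr s x0) xv -yv nsqrt_sqr //.
  by apply: contraNneq (mulf_neq0 s0 v0) => y0; rewrite -yv y0 expr0n.
have tot : (\sum_v nsqrt v = q)%N.
  rewrite /q -sum1_card [RHS](partition_big (fun x : F => x ^+ 2) xpredT) //=.
  by apply: eq_bigr => v _; rewrite sum1dep_card.
have : (\sum_v (2 - (nsqrt v + nsqrt (s * v)%R)) = 0)%N.
  rewrite sumnB; last by move=> *; exact: le2.
  have := tot; rewrite (reindex_inj (mulfI s0)) /= => tots.
  by rewrite big_split /= tot tots sum_nat_const muln2 addnn subnn.
move/eqP; rewrite sum_nat_eq0 => /forallP/(_ u); rewrite subn_eq0 => h.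
by apply/eqP; rewrite eqn_leq le2.
Qed.

Lemma quad_charM s u : s != 0 -> quad_char (s * u) = quad_char s * quad_char u.
Proof.
move=> s0; rewrite /quad_char; case: (eqVneq (nsqrt s) 2) => [s2|/(nsqrt_nonsquare s0) ns].
  have /set0Pn[x] : [set x : F | x ^+ 2 == s] != set0 by rewrite -card_gt0 -/(nsqrt s) s2.
  rewrite inE => /eqP xs; rewrite s2 -xs [x ^+ 2 * u]mulrC nsqrt_mul_sqr; last first.
    by apply: contraNneq s0 => x0; rewrite -xs x0 expr0n.
  by rewrite (_ : 2 - 1 = 1 :> C) ?mul1r //; ring.
have := nsqrt_mul_nonsquare u s0 ns => /(congr1 (fun n => n%:R : C)).
rewrite natrD ns => h;
  have -> : (nsqrt (s * u))%:R = 2 - (nsqrt u)%:R :> C by rewrite -h addrC addKr.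
by ring.
Qed.

Lemma quad_char_sqr u : u != 0 -> quad_char u ^+ 2 = 1.
Proof.
move=> u0; rewrite /quad_char; case: (eqVneq (nsqrt u) 2) => [->|/(nsqrt_nonsquare u0) ->];
  ring.
Qed.

(** The weight [nsqrt] is 1 plus the quadratic character, and the 1 contributes nothing because
    [chi] sums to zero. *)
Lemma gaussE s : s != 0 -> gauss s = quad_char s * gauss 1.
Proof.
move=> s0; have g1 : gauss 1 = \sum_u (nsqrt u)%:R * chi u.
  by rewrite -sum_nsqrt; apply: eq_bigr => z _; rewrite mul1r.
rewrite g1 /gauss (sum_nsqrt (fun u => chi (s * u))) [LHS](reindex_inj (mulfI s0)) /=.
rewrite [LHS](reindex_inj (mulfI (invr_neq0 (mulf_neq0 s0 s0)))) /=.
have e u : s * (s * ((s * s)^-1 * u)) = u by field; rewrite s0.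
have e2 u : nsqrt (s * ((s * s)^-1 * u)) = nsqrt (s * u).
  by rewrite -(nsqrt_mul_sqr _ s0); congr nsqrt; field; rewrite s0.
under eq_bigr do rewrite e e2.
have sq u : (nsqrt (s * u))%:R = 1 + quad_char s * ((nsqrt u)%:R - 1) :> C.
  by rewrite -/(quad_char u) -quad_charM // /quad_char; ring.
rewrite (eq_bigr (fun u => (1 - quad_char s) * chi u + quad_char s * ((nsqrt u)%:R * chi u))).
  by rewrite big_split /= -!mulr_sumr sum_char // mulr0 add0r.
by move=> u _; rewrite sq; ring.
Qed.

Lemma norm_gauss s : s != 0 -> `|gauss s| ^+ 2 = q%:R.
Proof.
move=> s0; rewrite normCK /gauss rmorph_sum mulr_sumr.
rewrite (eq_bigr (fun y => \sum_u chi (s * u ^+ 2) * chi (y * (2 * s * u)))); last first.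
  move=> y _; rewrite mulr_suml (reindex_inj (addrI y)) /=; apply: eq_bigr => u _.
  by rewrite -(addcharN chiP) -!(addcharD chiP); congr chi; ring.
rewrite exchange_big /=.
under eq_bigr do rewrite -mulr_sumr (sum_charM chiP).
rewrite (bigD1 0) //= big1 => [|u u0];
  last by rewrite !mulf_eq0 (negPf two_neq0) (negPf s0) (negPf u0) mulr0.
by rewrite mulr0 eqxx expr0n mulr0 (addchar0 chiP) mul1r addr0.
Qed.

Lemma complete_square s w : s != 0 ->
  \sum_z chi (s * z ^+ 2 + z * w) = chi (- (w ^+ 2 / (4 * s))) * gauss s.
Proof.
move=> s0; rewrite (reindex_inj (addIr (- (w / (2 * s))))) /= mulr_sumr.
apply: eq_bigr => z _; rewrite -(addcharD chiP); congr chi.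
by field; rewrite s0 ?two_neq0 ?four_neq0.
Qed.

Hypothesis archC : forall x : C, 0 <= x -> exists n : nat, x <= n%:R.

(** Multiplied by the Gauss sum, each summand becomes a sum over z by completing the square
    backwards. Summing over s first then leaves q times a sum over at most two square roots z, minus
    the term s = 0, so the product is at most 2 q while the Gauss sum has modulus sqrt q. *)
Lemma salie_bound t b : t != 0 ->
  `|\sum_(s | s != 0) quad_char s * chi (- (s * t) - b / s)| ^+ 2 <= 4 * q%:R.
Proof.
move=> t0; set T := \sum_(s | _) _.
have q0 : 0 < q%:R :> C by rewrite ltr0n (ltnW (finNzRing_gt1 F)).
(* Completing the square needs w^2 = 4 g b with g nonzero: g = w = 4 b, or g = 1 and w = 0 when b =
   0. *)
pose g := if b == 0 then 1 else 4 * b.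
have four0 := four_neq0.
have g0 : g != 0 by rewrite /g; case: ifPn => b0; rewrite ?oner_neq0 ?mulf_neq0.
pose w := if b == 0 then 0 else 4 * b.
have wb s : s != 0 -> w ^+ 2 / (4 * (s * g)) = b / s.
  move=> s0; rewrite /w /g; case: ifPn => [/eqP->|b0]; first by rewrite expr0n /= !mul0r.
  by field; rewrite s0 b0 four0.
suff h : `|gauss 1 * T| <= 2 * q%:R.
  rewrite -(ler_pM2l q0) -{1}(norm_gauss (oner_neq0 _)) -exprMn -normrM.
  have -> : q%:R * (4 * q%:R) = (2 * q%:R) ^+ 2 :> C by ring.
  by rewrite lerXn2r ?nnegrE ?mulr_ge0 // ltW.
have eT : quad_char g * (gauss 1 * T) =
    \sum_(s | s != 0) chi (- (s * t)) * \sum_z chi (s * g * z ^+ 2 + z * w).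
  rewrite mulrA mulr_sumr; apply: eq_bigr => s s0.
  rewrite complete_square ?mulf_neq0 // wb // (gaussE (mulf_neq0 s0 g0)) quad_charM //.
  rewrite (addcharD chiP); ring.
have -> : `|gauss 1 * T| = `|quad_char g * (gauss 1 * T)|.
  rewrite [RHS]normrM (_ : `|quad_char g| = 1) ?mul1r //; apply/eqP.
  by rewrite -(@pexpr_eq1 _ _ 2) // -normrX quad_char_sqr // normr1.
have e0 : \sum_(s | s != 0) chi (- (s * t)) * (\sum_z chi (s * g * z ^+ 2 + z * w)) =
    \sum_z chi (z * w) * (q%:R *+ (g * z ^+ 2 == t)) - \sum_z chi (z * w).
  rewrite -sumrB.
  rewrite (eq_bigr (fun s => \sum_z chi (z * w) * chi (s * (g * z ^+ 2 - t)))); last first.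
    move=> s _; rewrite mulr_sumr; apply: eq_bigr => z _.
    by rewrite -!(addcharD chiP); congr chi; ring.
  rewrite exchange_big /=; apply: eq_bigr => z _.
  rewrite -mulr_sumr -[X in _ = _ - X]mulr1 -mulrBr; congr (_ * _).
  have := sum_charM chiP (g * z ^+ 2 - t); rewrite subr_eq0 => <-.
  by rewrite [in RHS](bigD1 0) //= mul0r (addchar0 chiP) [RHS]addrC addKr.
rewrite eT e0; set A := \sum_z _ * _.
have nA : A = q%:R * \sum_(z | g * z ^+ 2 == t) chi (z * w).
  rewrite mulr_sumr [RHS]big_mkcond; apply: eq_bigr => z _.
  by case: eqP => _; rewrite ?mulr0 // mulr1n mulrC.
have cA : leq #|[set z | g * z ^+ 2 == t]| 2.
  apply: leq_trans (nsqrt_le2 (t / g)); apply: subset_leq_card; apply/subsetP => z.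
  by rewrite !inE => /eqP <-; rewrite mulrC mulKf.
rewrite nA; case: (eqVneq b 0) => b0; last first.
  have -> : \sum_z chi (z * w) = 0.
    by rewrite (sum_charM chiP) /w (negPf b0) mulf_eq0 (negPf b0) (negPf four0).
  rewrite subr0 normrM normr_nat mulrC ler_pM2r // (le_trans (ler_norm_sum _ _ _)) //.
  rewrite (eq_bigr (fun _ => 1)) => [|z _]; last by rewrite (addchar_norm chiP).
  by rewrite sumr_const ler_nat; apply: leq_trans cA; rewrite cardsE.
have c1 z : chi (z * w) = 1 by rewrite /w b0 eqxx mulr0 (addchar0 chiP).
rewrite (eq_bigr (fun _ => 1)) ?sumr_const => [|z _ //].
rewrite (eq_bigr (fun _ => 1)) ?sumr_const => [|z _ //].
rewrite -/q -[X in _ - X]mulr1 -mulrBr normrM normr_nat mulrC ler_pM2r //.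
rewrite -cardsE; case: #|_| cA => [|[|[|]]] // _; rewrite ?mulr0n ?mulr1n.
- by rewrite sub0r normrN normr1 ler1n.
- by rewrite subrr normr0 ler0n.
by rewrite (_ : 1 *+ 2 - 1 = 1 :> C) ?normr1 ?ler1n // mulr2n addrK.
Qed.

Lemma twisted_kloosterman_bound d t b : t != 0 ->
  `|\sum_(s | s != 0) quad_char s ^+ d * chi (- (s * t) - b / s)| ^+ 2 <= 4 * q%:R.
Proof.
move=> t0; have [od|ed] := boolP (odd d).
  rewrite (eq_bigr (fun s => quad_char s * chi (- (s * t) - b / s))); last first.
    move=> s s0; congr (_ * _); rewrite -(odd_double_half d) od -mul2n exprD exprM.
    by rewrite quad_char_sqr // expr1n mulr1.
  exact: salie_bound.
rewrite (eq_bigr (fun s => chi (s * - t + - b / s))); last first.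
  move=> s s0; rewrite -(odd_double_half d) (negPf ed) add0n -mul2n exprM.
  by rewrite quad_char_sqr // expr1n mul1r mulrN mulNr.
(* For b = 0 the sum is that of a nontrivial character over nonzero s, which is -1. *)
have [->|b0] := eqVneq b 0; last by rewrite (kloosterman_weil2 chiP) ?oppr_eq0.
have := sum_charM chiP (- t); rewrite oppr_eq0 (negPf t0) mulr0n (bigD1 0) //=.
rewrite mul0r (addchar0 chiP) => /eqP; rewrite addrC addr_eq0 => /eqP h.
rewrite (eq_bigr (fun s => chi (s * - t))) => [|s _]; last by rewrite oppr0 mul0r addr0.
rewrite h normrN1 expr1n -natrM ler1n muln_gt0 /=; exact: ltnW (finNzRing_gt1 F).
Qed.
End Gauss.

(** * Fourier analysis on the vector space *)

Lemma sum_rV_prod (F : finFieldType) (C : comNzRingType) d (h : 'I_d -> F -> C) :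
  \sum_(x : 'rV[F]_d) \prod_i h i (x 0 i) = \prod_i \sum_z h i z.
Proof.
rewrite bigA_distr_bigA /= (reindex (fun f : {ffun 'I_d -> F} => \row_i f i)) /=.
  by apply: eq_bigr => f _; apply: eq_bigr => i _; rewrite mxE.
exists (fun x : 'rV_d => [ffun i => x 0 i]) => [f _|x _].
  by apply/ffunP => i; rewrite ffunE mxE.
by apply/rowP => i; rewrite mxE ffunE.
Qed.

Lemma dotpDl (F : finFieldType) d (x y z : 'rV[F]_d) : dotp (x + y) z = dotp x z + dotp y z.
Proof. by rewrite /dotp -big_split; apply: eq_bigr => i _; rewrite mxE mulrDl. Qed.
Lemma dotpC (F : finFieldType) d (x y : 'rV[F]_d) : dotp x y = dotp y x.
Proof. by apply: eq_bigr => i _; rewrite mulrC. Qed.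
Lemma dotpZl (F : finFieldType) d a (x z : 'rV[F]_d) : dotp (a *: x) z = a * dotp x z.
Proof. by rewrite /dotp mulr_sumr; apply: eq_bigr => i _; rewrite mxE mulrA. Qed.
Lemma dotpNl (F : finFieldType) d (x z : 'rV[F]_d) : dotp (- x) z = - dotp x z.
Proof. by rewrite -scaleN1r dotpZl mulN1r. Qed.

Section Fourier.
Variables (F : finFieldType) (C : numClosedFieldType) (chi : F -> C) (d : nat).
Hypothesis chiP : additive_char chi.
Let q := #|F|.
Local Notation V := 'rV[F]_d.
Let q_gt0 : 0 < q%:R :> C. Proof. by rewrite ltr0n (ltnW (finNzRing_gt1 F)). Qed.

Definition fourier (w : V -> C) (xi : V) : C := \sum_x w x * chi (dotp x xi).

Lemma addchar_sum (I : finType) (h : I -> F) : chi (\sum_i h i) = \prod_i chi (h i).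
Proof. by elim/big_rec2: _ => [|i y z _ <-]; rewrite ?(addchar0 chiP) ?(addcharD chiP). Qed.

Lemma sum_addchar_dotp (x : V) : \sum_xi chi (dotp x xi) = q%:R ^+ d *+ (x == 0).
Proof.
under eq_bigr do rewrite addchar_sum.
rewrite (sum_rV_prod (fun i z => chi (x 0 i * z))).
under eq_bigr => i _ do under eq_bigr do rewrite mulrC.
under eq_bigr do rewrite (sum_charM chiP).
have [->|x0] := eqVneq x 0.
  rewrite (eq_bigr (fun _ => q%:R)) => [|i _]; last by rewrite mxE eqxx.
  by rewrite prodr_const card_ord.
have /rV0Pn[i xi] := x0.
by rewrite (bigD1 i) //= (negPf xi) mulr0n mul0r.
Qed.

Lemma parseval w : \sum_xi `|fourier w xi| ^+ 2 = q%:R ^+ d * \sum_x `|w x| ^+ 2.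
Proof.
rewrite (eq_bigr (fun xi => \sum_x \sum_y w x * (w y)^* * chi (dotp (x - y) xi))); last first.
  move=> xi _; rewrite normCK /fourier rmorph_sum mulr_suml; apply: eq_bigr => x _.
  rewrite mulr_sumr; apply: eq_bigr => y _.
  by rewrite rmorphM dotpDl dotpNl (addcharD chiP) (addcharN chiP); ring.
rewrite exchange_big mulr_sumr; apply: eq_bigr => x _.
rewrite exchange_big /= (bigD1 x) //= [X in _ + X]big1 => [|y yx];
  rewrite -mulr_sumr sum_addchar_dotp.
  by rewrite subrr eqxx addr0 normCK mulrC.
by rewrite subr_eq0 eq_sym (negPf yx) mulr0.
Qed.

Lemma fourier_conv (f v : V -> C) xi :
  fourier (fun x => \sum_y f (x - y) * v y) xi = fourier f xi * fourier v xi.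
Proof.
rewrite /fourier mulr_sumr; under eq_bigr do rewrite mulr_suml.
rewrite exchange_big; apply: eq_bigr => y _.
rewrite (reindex_inj (addIr y)) mulr_suml; apply: eq_bigr => x _ /=.
by rewrite addrK dotpDl (addcharD chiP); ring.
Qed.

Lemma conv_bound (f v : V -> C) B : (forall xi, `|fourier f xi| ^+ 2 <= B) ->
  \sum_x `|\sum_y f (x - y) * v y| ^+ 2 <= B * \sum_x `|v x| ^+ 2.
Proof.
move=> fB; have qd0 : 0 < q%:R ^+ d :> C by rewrite exprn_gt0.
rewrite -(ler_pM2l qd0) -parseval mulrCA -parseval mulr_sumr.
apply: ler_sum => xi _; rewrite fourier_conv normrM exprMn ler_wpM2r // exprn_ge0 //.
Qed.

(** Subtracting 1/q removes exactly the frequency s = 0, which is why deviations are measured from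
    1/q rather than from the true edge density. *)
Lemma indicator_addchar (u t : F) :
  q%:R * ((u == t)%:R - q%:R^-1) = \sum_(s | s != 0) chi (s * (u - t)) :> C.
Proof.
have := sum_charM chiP (u - t); rewrite subr_eq0 (bigD1 0) //= mul0r (addchar0 chiP).
by move/(canRL (addKr _)) => ->; rewrite mulrBr mulfV ?gt_eqF // mulr_natr addrC.
Qed.

Section Sphere.
Hypothesis oddF : odd #|F|.
Hypothesis archC : forall x : C, 0 <= x -> exists n : nat, x <= n%:R.

(** For fixed s the sum factors over coordinates into Gauss sums; their product brings in the d-th
    power of the quadratic character, hence the dependence on the parity of d. *)
Lemma fourier_sphere t (xi : V) :
  q%:R * fourier (fun z => (normsq z == t)%:R - q%:R^-1) xi =
  gauss chi 1 ^+ d *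
    \sum_(s | s != 0) quad_char C s ^+ d * chi (- (s * t) - normsq xi / 4 / s).
Proof.
rewrite /fourier mulr_sumr.
under eq_bigr do rewrite mulrA indicator_addchar mulr_suml.
rewrite exchange_big mulr_sumr; apply: eq_bigr => s s0 /=.
have four0 : 4 != 0 :> F.
  by rewrite (_ : 4 = 2 * 2) ?mulf_neq0 ?odd_card_2_neq0 //; ring.
rewrite (eq_bigr (fun x : V => chi (- (s * t)) * \prod_i chi (s * x 0 i ^+ 2 + x 0 i * xi 0 i))).
  rewrite -mulr_sumr (sum_rV_prod (fun i z => chi (s * z ^+ 2 + z * xi 0 i))).
  rewrite (eq_bigr (fun i => chi (- (xi 0 i ^+ 2 / (4 * s))) * gauss chi s)); last first.
    by move=> i _; rewrite (complete_square chiP).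
  rewrite big_split /= -addchar_sum prodr_const card_ord (gaussE chiP) // exprMn.
  rewrite sumrN -mulr_suml -/(normsq xi) (addcharD chiP).
  have -> : normsq xi / (4 * s) = normsq xi / 4 / s by field; rewrite s0 four0.
  ring.
move=> x _; rewrite -addchar_sum -!(addcharD chiP) big_split /= -mulr_sumr.
rewrite -/(normsq x) -/(dotp x xi); congr chi; ring.
Qed.

Lemma fourier_sphere_bound t (xi : V) : (0 < d)%N -> t != 0 ->
  `|fourier (fun z => (normsq z == t)%:R - q%:R^-1) xi| ^+ 2 <= 4 * q%:R ^+ d.-1.
Proof.
move=> d0 t0; have q2 : 0 < q%:R ^+ 2 :> C by rewrite exprn_gt0.
rewrite -(ler_pM2l q2) -{1}[q%:R]normr_nat -exprMn -normrM fourier_sphere.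
rewrite normrM normrX exprMn exprAC norm_gauss ?oner_neq0 //.
have -> : q%:R ^+ 2 * (4 * q%:R ^+ d.-1) = q%:R ^+ d * (4 * q%:R) :> C.
  by have -> : q%:R ^+ d = q%:R * q%:R ^+ d.-1 :> C; [rewrite -exprS prednK|ring].
by rewrite ler_pM2l ?exprn_gt0 // twisted_kloosterman_bound.
Qed.
End Sphere.

(* Summed over a punctured line, the twisted dilates of [v] have the energy
   given by Parseval on the line. *)
Lemma dilation_bound t (v : V -> C) : t != 0 ->
  \sum_x `|\sum_(s | s != 0) chi (- (s * t)) * v (s^-1 *: x)| ^+ 2
    <= q%:R * \sum_x `|v x| ^+ 2.
Proof.
move=> t0; pose T x := \sum_(s | s != 0) chi (- (s * t)) * v (s^-1 *: x).
have q1 : 0 < q.-1%:R :> C by rewrite ltr0n; have := finNzRing_gt1 F; rewrite -/q; lia.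
have sc (G : V -> C) : \sum_x \sum_(r : F | r != 0) G (r *: x) = q.-1%:R * \sum_x G x.
  rewrite exchange_big /= (eq_bigr (fun _ => \sum_x G x)) => [|r r0]; last first.
    by rewrite [RHS](reindex_inj (scalerI r0)).
  by rewrite sumr_const mulr_natl; congr (_ *+ _); have := cardC1 (0 : F).
rewrite -(ler_pM2l q1) -sc mulrCA -sc mulr_sumr; apply: ler_sum => x _.
have Tr r : r != 0 -> T (r *: x) = \sum_(u | u != 0) chi (- (r * t) / u) * v (u *: x).
  move=> r0; rewrite /T (reindex (fun u => r / u)) /=; last first.
    by exists (fun u => r / u) => u u0; field; rewrite ?r0 ?andbT //; move: u0;
      rewrite inE mulf_eq0 invr_eq0 negb_or => /andP[].
  apply: eq_big => [u|u]; first by rewrite mulf_eq0 invr_eq0 (negPf r0).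
  rewrite mulf_eq0 invr_eq0 (negPf r0) /= => u0.
  by congr (chi _ * v _); rewrite ?scalerA; [field|congr (_ *: _); field; rewrite r0 u0].
apply: (@le_trans _ _ (\sum_r `|\sum_(u | u != 0) chi (- (r * t) / u) * v (u *: x)| ^+ 2)).
  rewrite [leRHS](bigD1 0) //= (eq_bigr (fun r => `|\sum_(u | u != 0) chi (- (r * t) / u) * v (u *: x)| ^+ 2)).
    by rewrite lerDr exprn_ge0.
  by move=> r r0; rewrite -Tr.
rewrite (eq_bigr (fun r => \sum_(u | u != 0) \sum_(w | w != 0)
    v (u *: x) * (v (w *: x))^* * chi (r * (t / w - t / u)))); last first.
  move=> r _; rewrite normCK rmorph_sum mulr_suml; apply: eq_bigr => u u0.
  rewrite mulr_sumr; apply: eq_bigr => w w0; rewrite rmorphM /= -(addcharN chiP).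
  rewrite mulrACA -(addcharD chiP) mulrC; congr (_ * chi _); field; by rewrite u0 w0.
rewrite exchange_big mulr_sumr; apply: ler_sum => u u0.
rewrite exchange_big /= (bigD1 u) //= [X in _ + X]big1 => [|w /andP[w0 wu]].
  by rewrite -mulr_sumr (sum_charM chiP) subrr eqxx addr0 normCK mulrC.
rewrite -mulr_sumr (sum_charM chiP) subr_eq0 (inj_eq (mulfI t0)) (inj_eq invr_inj).
by rewrite (negPf wu) mulr0.
Qed.

(** The kernel is not a convolution, so there are no Fourier eigenvalues. Instead y -> s y moves the
    frequency s from the character onto v, making q times the operator the Fourier transform of a
    twisted sum of dilates. Parseval costs q^d and the dilates cost q. *)
Lemma prod_op_bound t (v : V -> C) : (0 < d)%N -> t != 0 ->
  \sum_x `|\sum_y ((dotp x y == t)%:R - q%:R^-1) * v y| ^+ 2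
    <= q%:R ^+ d.-1 * \sum_x `|v x| ^+ 2.
Proof.
move=> d0 t0; have q2 : 0 < q%:R ^+ 2 :> C by rewrite exprn_gt0.
rewrite -(ler_pM2l q2) [leLHS]mulr_sumr.
pose w x := \sum_(s | s != 0) chi (- (s * t)) * v (s^-1 *: x).
rewrite (eq_bigr (fun x => `|fourier w x| ^+ 2)); last first.
  move=> x _.  rewrite -{1}[q%:R]normr_nat -exprMn -normrM; congr (`|_| ^+ 2).
  rewrite mulr_sumr /fourier; under [RHS]eq_bigr do rewrite mulr_suml.
  rewrite (eq_bigr (fun y => \sum_(s | s != 0) chi (s * (dotp x y - t)) * v y)); last first.
    by move=> y _; rewrite mulrA indicator_addchar mulr_suml.
  rewrite exchange_big [RHS]exchange_big; apply: eq_bigr => s s0 /=.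
  rewrite [RHS](reindex_inj (scalerI s0)); apply: eq_bigr => y _ /=.
  rewrite scalerA mulVf // scale1r dotpZl (dotpC y x) mulrAC -(addcharD chiP).
  by congr (chi _ * _); ring.
rewrite parseval.
apply: (@le_trans _ _ (q%:R ^+ d * (q%:R * \sum_x `|v x| ^+ 2))).
  by rewrite ler_pM2l ?exprn_gt0 // dilation_bound.
have -> : q%:R ^+ d = q%:R * q%:R ^+ d.-1 :> C by rewrite -exprS prednK.
by rewrite le_eqVlt; apply/orP; left; apply/eqP; ring.
Qed.
End Fourier.

(** [B] bounds the square of the operator norm of the adjacency operator minus the constant kernel
    1/q. *)
Definition quasirandom (R : realType) (V : finType) (e : rel V) (q B : R) :=
  forall v : V -> R,
    \sum_x (\sum_y ((e x y)%:R - q^-1) * v y) ^+ 2 <= B * \sum_x v x ^+ 2.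

Lemma complex_archi (R : realType) (x : R[i]) : 0 <= x -> exists n : nat, x <= n%:R.
Proof.
rewrite lecE => /andP[/eqP im re]; exists (Num.truncn (complex.Re x)).+1.
rewrite -(rmorph_nat (real_complex R)) lecE /= im eqxx /=.
by rewrite ltW // truncnS_gt.
Qed.

Lemma sqr_norm_real_complex (R : realType) (x : R) : `|x%:C%C| ^+ 2 = (x ^+ 2)%:C%C.
Proof. by rewrite normCK [X in _ * X]conjc_real -rmorphM. Qed.

Lemma quasirandom_complex (R : realType) (V : finType) (e : rel V) (q : nat) (B : R) :
  (forall v : V -> R[i],
    \sum_x `|\sum_y ((e x y)%:R - q%:R^-1) * v y| ^+ 2 <= B%:C%C * \sum_x `|v x| ^+ 2) ->
  quasirandom e q%:R B.
Proof.
move=> h v; have := h (fun x => (v x)%:C%C).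
rewrite -lecR rmorphM !rmorph_sum /=.
rewrite (eq_bigr (fun x => ((\sum_y ((e x y)%:R - q%:R^-1) * v y) ^+ 2)%:C%C)); last first.
  move=> x _; rewrite -sqr_norm_real_complex rmorph_sum /=; congr (`|_| ^+ 2).
  by apply: eq_bigr => y _; rewrite rmorphM rmorphB fmorphV !rmorph_nat.
by under [X in _ <= _ * X -> _]eq_bigr do rewrite sqr_norm_real_complex.
Qed.

Lemma dist_quasirandom (R : realType) (F : finFieldType) d (t : F) :
  odd #|F| -> (0 < d)%N -> t != 0 ->
  quasirandom (@dist_rel F d t) #|F|%:R (4 * #|F|%:R ^+ d.-1 : R).
Proof.
move=> oF d0 t0; apply: quasirandom_complex => v.
have [chi chiP] := exists_additive_char F R[i].
have := conv_bound chiP v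
  (fun xi => fourier_sphere_bound chiP oF (@complex_archi R) xi d0 t0).
by rewrite rmorphM rmorphXn !rmorph_nat.
Qed.

(** Points with x.x = t are loops; deleting them gives the irreflexive relation needed later. This
    subtracts a 0/1 diagonal, and (b - v)^2 <= 2 b^2 + 2 v^2 turns q^(d-1) into 2 q^(d-1) + 2, still
    within the bound valid for distances. *)
Lemma prod_quasirandom (R : realType) (F : finFieldType) d (t : F) :
  (0 < d)%N -> t != 0 ->
  quasirandom (fun x y : 'rV[F]_d => (x != y) && prod_rel t x y) #|F|%:R (4 * #|F|%:R ^+ d.-1 : R).
Proof.
move=> d0 t0.
have loops : quasirandom (@prod_rel F d t) #|F|%:R (#|F|%:R ^+ d.-1 : R).
  apply: quasirandom_complex => v.
  have [chi chiP] := exists_additive_char F R[i].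
  by have := prod_op_bound chiP v d0 t0; rewrite rmorphXn !rmorph_nat.
move=> v; have := loops v; set A := \sum_x _ => hA; set B := \sum_x v x ^+ 2 in hA *.
have q1 : 1 <= #|F|%:R ^+ d.-1 :> R.
  by rewrite exprn_ege1 // ler1n (ltnW (finNzRing_gt1 F)).
have B0 : 0 <= B by apply: sumr_ge0 => x _; rewrite sqr_ge0.
apply: (@le_trans _ _ (2 * A + 2 * B)); last by nra.
rewrite /A /B !mulr_sumr -big_split; apply: ler_sum => x _ /=.
set a := \sum_y _; set b := \sum_y _.
have -> : a = b - (prod_rel t x x)%:R * v x.
  rewrite /a /b [in RHS](bigD1 x) //= [in LHS](bigD1 x) //= eqxx /=.
  rewrite (eq_bigr (fun y => ((prod_rel t x y)%:R - #|F|%:R^-1) * v y)); first by ring.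
  by move=> y yx; rewrite eq_sym yx.
case: (prod_rel t x x); rewrite ?mul1r ?mul0r ?subr0.
  by have := sqr_ge0 (b + v x); rewrite !expr2; nra.
by rewrite !expr2; have := sqr_ge0 b; have := sqr_ge0 (v x); rewrite !expr2; lra.
Qed.

(** * Operator norms and closed walks *)

Section OperatorNorm.
Variables (R : rcfType) (N : nat).
Implicit Types (u w : 'cV[R]_N) (M : 'M[R]_N).

Definition ip u w : R := \sum_i u i 0 * w i 0.
Definition nsq u : R := ip u u.
Definition opnorm_le M (c : R) := 0 <= c /\ forall u, nsq (M *m u) <= c ^+ 2 * nsq u.

Lemma nsq_ge0 u : 0 <= nsq u.
Proof. by apply: sumr_ge0 => i _; rewrite -expr2 sqr_ge0. Qed.

Lemma ipDl u v w : ip (u + v) w = ip u w + ip v w.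
Proof. by rewrite /ip -big_split; apply: eq_bigr => i _; rewrite mxE mulrDl. Qed.
Lemma ipC u w : ip u w = ip w u.
Proof. by apply: eq_bigr => i _; rewrite mulrC. Qed.
Lemma ipZl a u w : ip (a *: u) w = a * ip u w.
Proof. by rewrite /ip mulr_sumr; apply: eq_bigr => i _; rewrite mxE mulrA. Qed.

Lemma cauchy_schwarz u w : ip u w ^+ 2 <= nsq u * nsq w.
Proof.
have [w0|wn0] := eqVneq (nsq w) 0.
  have wi i : w i 0 = 0.
    move/eqP: w0; rewrite /nsq /ip psumr_eq0 => [/allP/(_ i (mem_index_enum i))|j _].
      by rewrite -expr2 sqrf_eq0 => /eqP.
    by rewrite -expr2 sqr_ge0.
  by rewrite w0 mulr0 /ip big1 ?expr0n // => i _; rewrite wi mulr0.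
have wp : 0 < nsq w by rewrite lt_def wn0 nsq_ge0.
have := nsq_ge0 (nsq w *: u + (- ip u w) *: w).
rewrite /nsq !(ipDl, ipZl) -!/(nsq _) ![ip _ (_ + _)]ipC !(ipDl, ipZl) -!/(nsq _) [ip w u]ipC.
move=> h; rewrite -(ler_pM2l wp) -subr_ge0; apply: le_trans h _.
by rewrite le_eqVlt; apply/orP; left; apply/eqP; rewrite /nsq; ring.
Qed.

Lemma ip_bound u w a b : 0 <= a -> 0 <= b -> nsq u <= a ^+ 2 -> nsq w <= b ^+ 2 ->
  `|ip u w| <= a * b.
Proof.
move=> a0 b0 ua wb; rewrite -(@ler_pXn2r _ 2) ?nnegrE ?mulr_ge0 //.
rewrite real_normK ?num_real // exprMn (le_trans (cauchy_schwarz _ _)) //.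
by rewrite ler_pM ?nsq_ge0.
Qed.

Lemma opnorm_mul M M' a b : opnorm_le M a -> opnorm_le M' b -> opnorm_le (M * M') (a * b).
Proof.
move=> [a0 Ma] [b0 Mb]; split=> [|u]; first exact: mulr_ge0.
rewrite -mulmxE -mulmxA; apply: (le_trans (Ma _)).
by rewrite exprMn -[leRHS]mulrA; apply: ler_wpM2l; rewrite ?sqr_ge0.
Qed.

Lemma opnorm1 : opnorm_le 1 1.
Proof. by split=> // u; rewrite mul1mx expr1n mul1r. Qed.

Lemma opnorm_exp M c k : opnorm_le M c -> opnorm_le (M ^+ k) (c ^+ k).
Proof.
move=> Mc; elim: k => [|k IH]; first by rewrite !expr0; exact: opnorm1.
by rewrite !exprS; exact: opnorm_mul.
Qed.

Lemma sqr_sqrt_nsq u : nsq u = Num.sqrt (nsq u) ^+ 2.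
Proof. by rewrite sqr_sqrtr ?nsq_ge0. Qed.

Lemma opnorm_add M M' a b : opnorm_le M a -> opnorm_le M' b -> opnorm_le (M + M') (a + b).
Proof.
move=> [a0 Ma] [b0 Mb]; split=> [|u]; first exact: addr_ge0.
have s0 := sqrtr_ge0 (nsq u); have := sqr_sqrt_nsq u; set s := Num.sqrt _ in s0 * => us.
have h1 := Ma u; have h2 := Mb u.
have h3 : `|ip (M *m u) (M' *m u)| <= (a * s) * (b * s).
  by apply: ip_bound; rewrite ?mulr_ge0 // exprMn -us.
have {}h3 := le_trans (ler_norm _) h3.
rewrite mulmxDl /nsq ipDl ![ip _ (_ + _)]ipC !ipDl [ip (M' *m u) (M *m u)]ipC -/(nsq _).
move: h1 h2; rewrite /nsq -/(nsq u) us => h1 h2; nra.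
Qed.

Lemma opnorm_ip M c u : opnorm_le M c -> `|ip u (M *m u)| <= c * nsq u.
Proof.
move=> [c0 Mc]; have us := sqr_sqrt_nsq u.
have := @ip_bound u (M *m u) (Num.sqrt (nsq u)) (c * Num.sqrt (nsq u)).
rewrite -us lexx exprMn -us sqrtr_ge0 mulr_ge0 ?sqrtr_ge0 // => /(_ isT isT isT (Mc u)).
by rewrite mulrCA -expr2 -us.
Qed.

Lemma sym_exp M k : M^T = M -> (M ^+ k)^T = M ^+ k.
Proof.
move=> sM; elim: k => [|k IH]; first by rewrite expr0 trmx1.
by rewrite exprS -mulmxE trmx_mul IH sM !mulmxE -exprSr exprS.
Qed.

(** The entry is the inner product of a column with its image under [M ^+ a]. Keeping two factors
    aside makes the sum over i a Hilbert-Schmidt norm, with no loss of a factor N. *)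
Lemma diag_exp_bound M c a i : M^T = M -> opnorm_le M c ->
  `|(M ^+ a.+2) i i| <= c ^+ a * nsq (col i M).
Proof.
move=> sM Mc; suff -> : (M ^+ a.+2) i i = ip (col i M) (M ^+ a *m col i M).
  by apply: opnorm_ip; exact: opnorm_exp.
rewrite exprS exprSr -!mulmxE mxE; apply: eq_bigr => j _; congr (_ * _).
  by rewrite -{1}sM !mxE.
by rewrite !mxE; apply: eq_bigr => l _; rewrite !mxE.
Qed.
End OperatorNorm.

Lemma exp_sub_telescope (R : pzRingType) (a b : R) n :
  a ^+ n - b ^+ n = \sum_(k < n) b ^+ k * (a - b) * a ^+ (n - k.+1).
Proof.
elim: n => [|n IH]; first by rewrite big_ord0 !expr0 subrr.
rewrite big_ord_recr /= subnn expr0 mulr1.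
rewrite (eq_bigr (fun k : 'I_n => b ^+ k * (a - b) * a ^+ (n - k.+1) * a)).
  by rewrite -mulr_suml -IH !exprSr mulrBl mulrBr addrA subrK.
by move=> k _; rewrite -[in RHS]mulrA -exprSr subSS -subSn.
Qed.

Section Adjacency.
Variables (R : rcfType) (N : nat) (e : rel 'I_N) (q beta : R).
Definition adj : 'M[R]_N := \matrix_(i, j) (e i j)%:R.
Let J : 'M[R]_N := const_mx q^-1.
Let S : R := N%:R / q.
Let one : 'cV[R]_N := const_mx 1.
Let Lam := S + beta.
Hypothesis e_sym : symmetric e.
Hypothesis q_gt0 : 0 < q.
Hypothesis dev : opnorm_le (adj - J) beta.

Let S_ge0 : 0 <= S. Proof. by rewrite divr_ge0 // ltW. Qed.
Let qi_ge0 : 0 <= q^-1. Proof. by rewrite invr_ge0 ltW. Qed.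
Let beta_ge0 : 0 <= beta. Proof. by case: dev. Qed.
Let Lam_ge0 : 0 <= Lam. Proof. exact: addr_ge0. Qed.

Let adj_sym : adj^T = adj.
Proof. by apply/matrixP => i j; rewrite !mxE e_sym. Qed.

Let ip_one u : ip one u = \sum_i u i 0.
Proof. by apply: eq_bigr => i _; rewrite mxE mul1r. Qed.

Let nsq_one : nsq one = N%:R.
Proof. by rewrite /nsq ip_one (eq_bigr (fun _ => 1)) ?sumr_const ?card_ord // => i _;
  rewrite mxE. Qed.

Let J_mul u : J *m u = (q^-1 * ip one u) *: one.
Proof.
apply/colP => i; rewrite !mxE mulr1 ip_one mulr_sumr; apply: eq_bigr => j _.
by rewrite mxE.
Qed.

Let opJ : opnorm_le J S.
Proof.
split=> // u; rewrite J_mul {1}/nsq ipZl [ip one (_ *: _)]ipC ipZl -/(nsq one) nsq_one.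
have := cauchy_schwarz one u; rewrite nsq_one -/(nsq u) => h.
have -> : q^-1 * ip one u * (q^-1 * ip one u * N%:R) = q^-1 ^+ 2 * N%:R * (ip one u ^+ 2).
  by ring.
have -> : S ^+ 2 * nsq u = q^-1 ^+ 2 * N%:R * (N%:R * nsq u) by rewrite /S; ring.
by rewrite ler_wpM2l // mulr_ge0 ?sqr_ge0.
Qed.

Lemma adj_opnorm : opnorm_le adj Lam.
Proof. by have := opnorm_add opJ dev; rewrite addrC subrK. Qed.

Let ip_one_pow M c : opnorm_le M c -> `|ip one (M *m one)| <= c * N%:R.
Proof. by move=> h; rewrite -nsq_one; apply: opnorm_ip. Qed.

Lemma deg_sum_bound : \sum_i \sum_j adj i j <= Lam * N%:R.
Proof.
have := le_trans (ler_norm _) (ip_one_pow adj_opnorm); apply: le_trans.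
rewrite ip_one; apply: ler_sum => i _; rewrite mxE; apply: ler_sum => j _.
by rewrite [one _ _]mxE mulr1.
Qed.

Lemma deg_sqr_bound : \sum_i (\sum_j adj i j) ^+ 2 <= Lam ^+ 2 * N%:R.
Proof.
case: adj_opnorm => _ /(_ one); rewrite nsq_one; apply: le_trans.
rewrite le_eqVlt; apply/orP; left; apply/eqP; apply: eq_bigr => i _.
rewrite expr2 !mxE; by congr (_ * _); apply: eq_bigr => j _; rewrite [one _ _]mxE mulr1.
Qed.

(** Peeling off one factor, J multiplies the total by S and A - J costs a factor beta; errors
    accumulate linearly in m. *)
Let walk_total m : `|ip one (adj ^+ m *m one) - N%:R * S ^+ m| <= N%:R * (m%:R * beta * Lam ^+ m.-1).
Proof.
elim: m => [|m IH]; first by rewrite !expr0 mul1mx -/(nsq one) nsq_one mulr1 subrr normr0 !mul0r mulr0.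
pose y := adj ^+ m *m one; pose z := (adj - J) *m y.
have -> : ip one (adj ^+ m.+1 *m one) - N%:R * S ^+ m.+1 =
    S * (ip one y - N%:R * S ^+ m) + ip one z.
  rewrite exprS -mulmxE -mulmxA -/y /z mulmxBl J_mul.
  rewrite ![ip one (_ + _)]ipC -scaleNr !(ipDl, ipZl) -/(nsq one) nsq_one ![ip _ one]ipC.
  by rewrite exprS /S; ring.
have zb : `|ip one z| <= N%:R * (beta * Lam ^+ m).
  have := ip_one_pow (opnorm_mul dev (opnorm_exp m adj_opnorm)).
  by rewrite -mulmxE -mulmxA -/y -/z mulrC.
rewrite (le_trans (ler_normD _ _)) //.
have SL : S <= Lam by rewrite lerDl.
have h : `|S * (ip one y - N%:R * S ^+ m)| <= N%:R * (m%:R * beta * Lam ^+ m).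
  rewrite normrM (ger0_norm S_ge0); case: m IH @y @z zb => [|m] IH y z zb.
    have -> : ip one y - N%:R * S ^+ 0 = 0.
      by rewrite /y expr0 mul1mx -/(nsq one) nsq_one expr0 mulr1 subrr.
    by rewrite normr0 !mul0r !mulr0.
  rewrite [Lam ^+ m.+1]exprS;
    apply: le_trans (_ : Lam * (N%:R * (m.+1%:R * beta * Lam ^+ m)) <= _); last first.
    by rewrite le_eqVlt; apply/orP; left; apply/eqP; ring.
  by rewrite ler_pM.
apply: (le_trans (lerD h zb)); rewrite le_eqVlt; apply/orP; left; apply/eqP.
by rewrite -pred_Sn -natr1; ring.
Qed.

Let tr_sandwich B m : \tr (B * J * adj ^+ m) = q^-1 * ip one (adj ^+ m *m (B *m one)).
Proof.
have -> : J = q^-1 *: (one *m one^T).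
  by apply/matrixP => i j; rewrite !mxE big_ord1 !mxE mulr1 mulr1.
rewrite -!mulmxE -scalemxAr -scalemxAl mxtraceZ; congr (_ * _).
have -> : B *m (one *m one^T) *m adj ^+ m = (B *m one) *m (one^T *m adj ^+ m) by rewrite !mulmxA.
rewrite mxtrace_mulC trace_mx11 -mulmxA mxE.
by rewrite ip_one; apply: eq_bigr => i _; rewrite !mxE mul1r.
Qed.

(** Entries are 0 or 1, so each squared deviation is linear in the entry, and the total is
    controlled by the number of edges, at most (S + beta) N with N = q S. *)
Let frob : \sum_i nsq (col i (adj - J)) <= q * S ^+ 2 + q * S * beta + S ^+ 2.
Proof.
have -> : \sum_i nsq (col i (adj - J)) =
    \sum_i \sum_j (adj i j * (1 - 2 / q) + q^-1 ^+ 2).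
  apply: eq_bigr => i _; apply: eq_bigr => j _; rewrite !mxE e_sym.
  by case: (e i j) => /=; ring.
have -> : \sum_i \sum_j (adj i j * (1 - 2 / q) + q^-1 ^+ 2) =
    (\sum_i \sum_j adj i j) * (1 - 2 / q) + S ^+ 2.
  rewrite (eq_bigr (fun i => (\sum_j adj i j) * (1 - 2 / q) + N%:R * q^-1 ^+ 2)).
    by rewrite big_split /= -mulr_suml sumr_const card_ord /S -mulr_natl; ring.
  by move=> i _; rewrite big_split /= -mulr_suml sumr_const card_ord -[_ ^+ 2 *+ _]mulr_natl.
rewrite lerD2r.
have d0 : 0 <= \sum_i \sum_j adj i j.
  by apply: sumr_ge0 => i _; apply: sumr_ge0 => j _; rewrite mxE.
apply: le_trans (_ : \sum_i \sum_j adj i j <= _).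
  by rewrite -[leRHS]mulr1 ler_wpM2l // gerBl divr_ge0 // ltW.
apply: (le_trans deg_sum_bound); rewrite le_eqVlt; apply/orP; left; apply/eqP.
by rewrite /Lam /S; field; rewrite gt_eqF.
Qed.

(** Telescoping A^n - R^n gives terms R^k J A^(n-1-k). As J has rank one, their traces are single
    inner products: k = 0 carries the main term S^n, and every other k has a factor beta. *)
Lemma trace_adj_bound n : (2 <= n)%N ->
  `|\tr (adj ^+ n) - S ^+ n| <= beta ^+ (n - 2) * (q * S ^+ 2 + q * S * beta + S ^+ 2)
     + 2 * n%:R * (S * (beta * Lam ^+ (n - 2))).
Proof.
case: n => [|[|m]] // _; rewrite subSS subSS subn0.
have bL : beta <= Lam by rewrite lerDr.
have devsym : (adj - J)^T = adj - J.
  by rewrite linearB /= adj_sym; congr (_ - _); apply/matrixP => i j; rewrite !mxE.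
have h1 : `|\tr ((adj - J) ^+ m.+2)| <= beta ^+ m * (q * S ^+ 2 + q * S * beta + S ^+ 2).
  apply: le_trans (_ : \sum_i beta ^+ m * nsq (col i (adj - J)) <= _).
    by apply: (le_trans (ler_norm_sum _ _ _)); apply: ler_sum => i _; apply: diag_exp_bound.
  by rewrite -mulr_sumr ler_wpM2l ?exprn_ge0 // frob.
have h2 : `|\tr (adj ^+ m.+2 - (adj - J) ^+ m.+2) - S ^+ m.+2| <=
    2 * m.+2%:R * (S * (beta * Lam ^+ m)).
  have JE : adj - (adj - J) = J by rewrite opprB addrC subrK.
  rewrite exp_sub_telescope JE linear_sum /= big_ord_recl /= addrAC.
  (* The term k = 0 costs m + 1 units, the others one each, m + 1 in all; two units are spare. *)
  rewrite (_ : 2 * m.+2%:R * (S * (beta * Lam ^+ m)) =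
      q^-1 * (N%:R * (m.+1%:R * beta * Lam ^+ m)) + S * (beta * Lam ^+ m) *+ m.+1
      + 2 * (S * (beta * Lam ^+ m))); last first.
    by rewrite -mulr_natl /S -!natr1; ring.
  rewrite -[leLHS]addr0; apply: lerD;
    last by rewrite mulr_ge0 ?(mulr_ge0 S_ge0 (mulr_ge0 beta_ge0 (exprn_ge0 m Lam_ge0))) //.
  rewrite (le_trans (ler_normD _ _)) //; apply: lerD.
    rewrite tr_sandwich mul1mx subSS subn0.
    have -> : q^-1 * ip one (adj ^+ m.+1 *m one) - S ^+ m.+2 =
       q^-1 * (ip one (adj ^+ m.+1 *m one) - N%:R * S ^+ m.+1).
      by rewrite [S ^+ m.+2]exprS {1}/S; ring.
    rewrite normrM (ger0_norm qi_ge0) ler_wpM2l //.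
  apply: (le_trans (ler_norm_sum _ _ _)).
  rewrite -[X in _ <= _ *+ X](card_ord m.+1) -sumr_const; apply: ler_sum => i _.
  rewrite tr_sandwich normrM (ger0_norm qi_ge0) mulmxA mulmxE.
  have := ip_one_pow (opnorm_mul (opnorm_exp (m.+2 - (bump 0 i).+1) adj_opnorm) (opnorm_exp (bump 0 i) dev)).
  move=> h; apply: (le_trans (ler_wpM2l qi_ge0 h)).
  have -> : q^-1 * (Lam ^+ (m.+2 - (bump 0 i).+1) * beta ^+ bump 0 i * N%:R) =
     S * (beta * (Lam ^+ (m - i) * beta ^+ i)).
    by rewrite /bump /= add1n !subSS [beta ^+ i.+1]exprS /S; ring.
  rewrite ler_wpM2l // ler_wpM2l // (_ : Lam ^+ m = Lam ^+ (m - i) * Lam ^+ i);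
    last by rewrite -exprD subnK // -ltnS.
  by rewrite ler_wpM2l ?exprn_ge0 // lerXn2r.
have -> : \tr (adj ^+ m.+2) - S ^+ m.+2 = \tr ((adj - J) ^+ m.+2) +
   (\tr (adj ^+ m.+2 - (adj - J) ^+ m.+2) - S ^+ m.+2).
  by rewrite linearB /=; ring.
by rewrite (le_trans (ler_normD _ _)) // lerD.
Qed.

End Adjacency.

(** * Counting closed walks and walks with a repeated vertex *)

Lemma sum_tupleS (R : nmodType) (T : finType) k (G : k.+1.-tuple T -> R) :
  \sum_p G p = \sum_z \sum_(p : k.-tuple T) G [tuple of z :: p].
Proof.
rewrite pair_big (reindex (fun zp : T * k.-tuple T => [tuple of zp.1 :: zp.2])) //=.
exists (fun p : k.+1.-tuple T => (thead p, [tuple of behead p])) => [[z p] _|p _].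
  by congr (_, _); apply: val_inj.
by rewrite /= -tuple_eta.
Qed.

Lemma leq_card_bigcup_sum (I T : finType) (P : I -> {set T}) :
  (#|\bigcup_i P i| <= \sum_i #|P i|)%N.
Proof.
elim/big_rec2: _ => [|i y z _ h]; first by rewrite cards0.
by rewrite (leq_trans (leq_card_setU _ _)) // leq_add2l.
Qed.

Section WalkCount.
Variables (R : rcfType) (N : nat) (e : rel 'I_N).
Local Notation A := (adj R e).

Lemma sum_path k x y :
  \sum_(p : k.-tuple 'I_N) (path e x (rcons p y))%:R = (A ^+ k.+1) x y.
Proof.
elim: k x => [|k IH] x.
  rewrite (big_pred1 [tuple]) => [|p]; last by rewrite [p]tuple0; apply/esym/eqP.
  by rewrite expr1 mxE /= andbT.
rewrite sum_tupleS exprS -mulmxE mxE; apply: eq_bigr => z _.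
rewrite -IH mulr_sumr; apply: eq_bigr => p _.
by rewrite mxE -natrM mulnb.
Qed.

Lemma sum_path_through k b x y v : (b < k)%N ->
  \sum_(p : k.-tuple 'I_N) ((nth y p b == v) && path e x (rcons p y))%:R =
  (A ^+ b.+1) x v * (A ^+ (k - b)) v y.
Proof.
elim: b k x => [|b IH] [|k] x // bk.
  rewrite sum_tupleS subn0 expr1 (bigD1 v) //= [X in _ + X]big1 ?addr0.
    rewrite -sum_path mulr_sumr; apply: eq_bigr => p _.
    by rewrite eqxx mxE -natrM mulnb.
  by move=> z zv; rewrite big1 // => p _; rewrite (negPf zv).
rewrite sum_tupleS subSS exprS -mulmxE mxE mulr_suml; apply: eq_bigr => z _.
rewrite -mulrA -IH // mulr_sumr; apply: eq_bigr => p _ /=.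
by rewrite mxE -natrM mulnb andbCA.
Qed.

Lemma closed_walks_trace k :
  (#|[set x : k.+1.-tuple 'I_N | path.cycle e x]|)%:R = \tr (A ^+ k.+1).
Proof.
rewrite -sum1dep_card natr_sum big_mkcond sum_tupleS; apply: eq_bigr => z _.
by rewrite -sum_path; apply: eq_bigr => p _; rewrite /=; case: (path _ _ _).
Qed.

(** ['I_N] may be empty, so no default is available for [nth]; quantifying over it is harmless
    because [b < n] keeps both positions in range. *)
Definition pinched n b := [set x : n.-tuple 'I_N | path.cycle e x &
  (b < n)%N && [forall z, nth z x 0 == nth z x b]].

Lemma card_pinched k b : (b < k)%N ->
  (#|pinched k.+1 b.+1|)%:R = \sum_v (A ^+ b.+1) v v * (A ^+ (k - b)) v v.
Proof.
move=> bk; rewrite -sum1dep_card natr_sum big_mkcond sum_tupleS; apply: eq_bigr => v _.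
rewrite -sum_path_through //; apply: eq_bigr => p _.
rewrite ltnS bk /= andbC; have -> : [forall z, v == nth z p b] = (nth v p b == v).
  apply/forallP/eqP => [/(_ v)/eqP <- //|h z].
  by rewrite (set_nth_default v) ?size_tuple // h.
by case: (_ && _).
Qed.

Lemma card_rot_preim n i (Z : {set n.-tuple 'I_N}) :
  (#|[set x : n.-tuple 'I_N | [tuple of rot i x] \in Z]| <= #|Z|)%N.
Proof.
have inj : injective (fun x : n.-tuple 'I_N => [tuple of rot i x]).
  by move=> x y /(congr1 val)/= /rot_inj h; apply: val_inj.
rewrite -(card_imset _ inj); apply: subset_leq_card; apply/subsetP => _ /imsetP[x + ->].
by rewrite inE.
Qed.

(** A rotation brings one of two equal entries to the front; the walk is recovered from the
    rotation, so each pair (i, b) costs at most one pinched set. *)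
Lemma degenerate_bound k :
  (#|[set x : k.+1.-tuple 'I_N | path.cycle e x & ~~ uniq x]|
     <= \sum_(i < k.+1) \sum_(b < k) #|pinched k.+1 b.+1|)%N.
Proof.
pose P (i : 'I_k.+1) (b : 'I_k) := [set x : k.+1.-tuple 'I_N | [tuple of rot i x] \in pinched k.+1 b.+1].
apply: (@leq_trans #|\bigcup_i \bigcup_b P i b|); last first.
  apply: (leq_trans (leq_card_bigcup_sum _)); apply: leq_sum => i _.
  apply: (leq_trans (leq_card_bigcup_sum _)); apply: leq_sum => b _.
  exact: card_rot_preim.
apply: subset_leq_card; apply/subsetP => x; rewrite inE => /andP[cx nx].
have z0 := tnth x 0.
have /(uniqPn z0)[i [j [ij jk ijE]]] := nx; rewrite size_tuple in jk.
have ik := ltn_trans ij jk.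
have bk : (j - i.+1 < k)%N by lia.
apply/bigcupP; exists (Ordinal ik) => //; apply/bigcupP; exists (Ordinal bk) => //.
rewrite !inE /= rot_cycle cx ltnS bk /=; apply/forallP => z.
have -> : (j - i.+1).+1 = (j - i)%N by lia.
rewrite /rot !nth_cat size_drop size_tuple.
rewrite subn_gt0 ik ltn_sub2r // !nth_drop addn0 subnKC; last exact: ltnW.
by rewrite (set_nth_default z0) ?size_tuple // ijE (set_nth_default z) ?size_tuple.
Qed.

Lemma nondegenerate_count k :
  (#|[set x : k.+1.-tuple 'I_N | path.cycle e x]| =
   #|[set x : k.+1.-tuple 'I_N | uniq x & path.cycle e x]| +
   #|[set x : k.+1.-tuple 'I_N | path.cycle e x & ~~ uniq x]|)%N.
Proof.
rewrite -(cardsID [set x : k.+1.-tuple 'I_N | uniq x]); congr (_ + _)%N.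
  by apply: eq_card => x; rewrite !inE andbC.
by apply: eq_card => x; rewrite !inE andbC.
Qed.

End WalkCount.

Lemma ncycles_induced (F : finFieldType) d (r : rel 'rV[F]_d) (E : {set 'rV[F]_d}) n :
  ncycles r E n =
  #|[set x : n.-tuple 'I_#|E| | uniq x & path.cycle (fun i j => r (enum_val i) (enum_val j)) x]|.
Proof.
pose f (x : n.-tuple 'I_#|E|) : n.-tuple 'rV[F]_d := [tuple of map enum_val x].
have fI : injective f.
  by move=> x y /(congr1 val)/= /(inj_map enum_val_inj) h; apply: val_inj.
rewrite -(card_imset _ fI); apply: eq_card => y; rewrite inE.
apply/idP/imsetP => [/and3P[yE uy cy]|[x]].
  have [x xy] : exists x : n.-tuple 'I_#|E|, f x = y.
    case: n @f fI y yE uy cy => [|n] f fI y yE uy cy.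
      by exists [tuple]; apply: val_inj; rewrite /= [in RHS]tuple0.
    have y0 : tnth y ord0 \in E by move/allP: yE; apply; rewrite mem_tnth.
    exists [tuple of map (enum_rank_in y0) y]; apply: val_inj => /=.
    rewrite -map_comp map_id_in // => z zy /=; rewrite enum_rankK_in //.
    by move/allP: yE; apply.
  exists x => //; rewrite inE; move: uy cy; rewrite -xy /= map_inj_uniq;
    last exact: enum_val_inj.
  by move=> ->; rewrite cycle_map.
rewrite inE => /andP[ux cx] ->; rewrite /= map_inj_uniq ?ux ?cycle_map;
  last exact: enum_val_inj.
rewrite /= andbC; apply/andP; split=> //.
by apply/allP => z /mapP[i _ ->]; exact: enum_valP.
Qed.

(** * Bounds for degenerate closed walks *)

Section Degenerate.
Variables (R : rcfType) (N : nat) (e : rel 'I_N) (q beta : R).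
Local Notation A := (adj R e).
Hypothesis e_sym : symmetric e.
Hypothesis e_irr : irreflexive e.
Hypothesis q_gt0 : 0 < q.
Hypothesis dev : opnorm_le (A - const_mx q^-1) beta.
Let Lam := N%:R / q + beta.
Let deg v : R := \sum_j A v j.

Let Lam_ge0 : 0 <= Lam.
Proof. by case: dev => b0 _; rewrite addr_ge0 // divr_ge0 // ltW. Qed.

Let A_ge0 i j : 0 <= A i j. Proof. by rewrite mxE. Qed.
Let Aexp_ge0 k i j : 0 <= (A ^+ k) i j.
Proof.
elim: k i j => [|k IH] i j; first by rewrite expr0 mxE; case: eqP.
by rewrite exprS -mulmxE mxE; apply: sumr_ge0 => l _; rewrite mulr_ge0.
Qed.
Let deg_ge0 v : 0 <= deg v. Proof. exact: sumr_ge0. Qed.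
Let A_diag v : A v v = 0. Proof. by rewrite mxE e_irr. Qed.
Let A_symE i j : A i j = A j i. Proof. by rewrite !mxE e_sym. Qed.
Let A_tr : A^T = A. Proof. by apply/matrixP => i j; rewrite mxE A_symE. Qed.

Let nsq_col v : nsq (col v A) = deg v.
Proof. by apply: eq_bigr => j _; rewrite !mxE e_sym -natrM mulnb andbb. Qed.

Let closed_le a v : (A ^+ a.+2) v v <= Lam ^+ a * deg v.
Proof.
rewrite -nsq_col; apply: (le_trans (ler_norm _)).
apply: diag_exp_bound => //; exact: (adj_opnorm q_gt0 dev).
Qed.

(** Without loops a piece of length one contributes nothing, so B is asked for only when both pieces
    have length at least two. *)
Lemma degenerate_le_bound k B : 0 <= B ->
  (forall b, (b < k)%N -> (0 < b)%N -> (b.+1 < k)%N ->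
     \sum_v (A ^+ b.+1) v v * (A ^+ (k - b)) v v <= B) ->
  (#|[set x : k.+1.-tuple 'I_N | path.cycle e x & ~~ uniq x]|)%:R <= k.+1%:R ^+ 2 * B.
Proof.
move=> B0 hB.
have : (#|[set x : k.+1.-tuple 'I_N | path.cycle e x & ~~ uniq x]|)%:R <=
   \sum_(i < k.+1) \sum_(b < k) (#|pinched e k.+1 b.+1|)%:R :> R.
  rewrite (eq_bigr (fun i => (\sum_(b < k) #|pinched e k.+1 b.+1|)%:R)); last by move=> i _;
    rewrite natr_sum.
  by rewrite -natr_sum ler_nat degenerate_bound.
move=> h; apply: (le_trans h); apply: le_trans (_ : \sum_(i < k.+1) \sum_(b < k) B <= _).
  apply: ler_sum => i _; apply: ler_sum => b _; rewrite card_pinched //.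
  have [b0|b0] := posnP b.
    by rewrite b0 expr1 big1 // => v _; rewrite A_diag mul0r.
  have [bk|bk] := ltnP b.+1 k; first exact: hB.
  have -> : (k - b = 1)%N by have := ltn_ord b; lia.
  by rewrite expr1 big1 // => v _; rewrite A_diag mulr0.
rewrite !sumr_const !card_ord -mulrnA -[B *+ _]mulr_natl ler_wpM2r // -natrX ler_nat; nia.
Qed.

(** Each piece contributes a degree and powers of Lam; the squared degrees then sum to at most Lam^2
    N. *)
Lemma degenerate_le k : (3 <= k)%N ->
  (#|[set x : k.+1.-tuple 'I_N | path.cycle e x & ~~ uniq x]|)%:R
    <= k.+1%:R ^+ 2 * (Lam ^+ k.-1 * N%:R).
Proof.
move=> k3; apply: degenerate_le_bound => [|b bk b0 bk1]; first by rewrite mulr_ge0 ?exprn_ge0.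
case: b bk b0 bk1 => // b bk _ bk1.
have -> : (k - b.+1 = (k - b - 3).+2)%N by lia.
apply: le_trans (_ : \sum_v Lam ^+ (b + (k - b - 3)) * deg v ^+ 2 <= _).
  apply: ler_sum => v _; rewrite exprD.
  have -> : Lam ^+ b * Lam ^+ (k - b - 3) * deg v ^+ 2 =
    Lam ^+ b * deg v * (Lam ^+ (k - b - 3) * deg v) by ring.
  by rewrite ler_pM.
have -> : (k.-1 = b + (k - b - 3) + 2)%N by lia.
rewrite -mulr_sumr [Lam ^+ (_ + 2)]exprD -[leRHS]mulrA ler_wpM2l ?exprn_ge0 //.
exact: (deg_sqr_bound q_gt0 dev).
Qed.

Section FewCommonNeighbours.
Variable D : R.
Hypothesis D_ge2 : 2 <= D.
Hypothesis deg_le : forall v, (#|[set z | e v z]|)%:R <= D.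
Hypothesis codeg_le : forall x y, x != y -> (#|[set z | e x z && e z y]| <= 2)%N.

Let degD v : deg v <= D.
Proof.
apply: le_trans (deg_le v); rewrite -sum1dep_card natr_sum [leRHS]big_mkcond /=.
by apply: ler_sum => z _; rewrite mxE; case: (e v z).
Qed.

Let sqr_diag v : (A ^+ 2) v v = deg v.
Proof.
by rewrite expr2 -mulmxE mxE; apply: eq_bigr => j _;
  rewrite !mxE [e j v]e_sym -natrM mulnb andbb.
Qed.

Let sqr_off x y : x != y -> (A ^+ 2) x y <= 2.
Proof.
move=> xy; apply: le_trans (_ : (#|[set z | e x z && e z y]|)%:R <= _); last first.
  by rewrite ler_nat codeg_le.
rewrite -sum1dep_card natr_sum [leRHS]big_mkcond expr2 -mulmxE mxE.
by apply: ler_sum => z _; rewrite !mxE -natrM mulnb; case: (_ && _).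
Qed.

Let cube_diag v : (A ^+ 3) v v <= 2 * deg v.
Proof.
rewrite exprS -mulmxE mxE /deg mulr_sumr; apply: ler_sum => y _; rewrite mulrC.
have [->|yv] := eqVneq y v; first by rewrite A_diag !mulr0.
by rewrite ler_wpM2r // sqr_off.
Qed.

(** This is the sum of the squares of (A^2)_vy. The term y = v is deg^2 <= D deg; elsewhere (A^2)_vy
    <= 2, and these entries sum to at most D deg. *)
Let fourth_diag v : (A ^+ 4) v v <= 3 * D * deg v.
Proof.
have -> : (A ^+ 4) v v = \sum_y (A ^+ 2) v y ^+ 2.
  rewrite (exprD _ 2 2) -mulmxE mxE; apply: eq_bigr => y _.
  by rewrite [_ ^+ 2 in RHS]expr2; congr (_ * _); rewrite -[in LHS](sym_exp 2 A_tr) mxE.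
rewrite (bigD1 v) //= sqr_diag.
apply: le_trans (_ : deg v ^+ 2 + 2 * \sum_y (A ^+ 2) v y <= _).
  rewrite lerD2l mulr_sumr [leRHS](bigD1 v) //= ler_wpDl ?mulr_ge0 //.
  by apply: ler_sum => y yv; rewrite expr2 ler_wpM2r // sqr_off // eq_sym.
have h : \sum_y (A ^+ 2) v y <= D * deg v.
  rewrite (eq_bigr (fun y => \sum_z A v z * A z y)) => [|y _];
    last by rewrite expr2 -mulmxE mxE.
  rewrite exchange_big /= /deg mulr_sumr; apply: ler_sum => z _.
  by rewrite -mulr_sumr mulrC ler_wpM2r // degD.
have := degD v; have := deg_ge0 v; rewrite expr2; nra.
Qed.

(** Five steps split only as 2 + 3, six only as 2 + 4 or 3 + 3, up to order. *)
Lemma degenerate_le_codegree k : k = 4%N \/ k = 5%N ->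
  (#|[set x : k.+1.-tuple 'I_N | path.cycle e x & ~~ uniq x]|)%:R
    <= k.+1%:R ^+ 2 * (3 * D ^+ (k - 3) * (Lam * N%:R)).
Proof.
have D0 : 0 <= D by apply: le_trans D_ge2.
move=> k45; apply: degenerate_le_bound => [|b bk b0 bk1].
  by rewrite mulr_ge0 ?mulr_ge0 ?exprn_ge0.
apply: le_trans (_ : \sum_v 3 * D ^+ (k - 3) * deg v <= _); last first.
  rewrite -mulr_sumr ler_wpM2l ?mulr_ge0 ?exprn_ge0 //.
  exact: (deg_sum_bound q_gt0 dev).
apply: ler_sum => v _.
have d0 := deg_ge0 v; have dD := degD v; have c2 := sqr_diag v.
have c3 := cube_diag v; have c4 := fourth_diag v.
have p3 := Aexp_ge0 3 v v; have p4 := Aexp_ge0 4 v v.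
have x2D : (A ^+ 3) v v <= 2 * D by apply: (le_trans c3); rewrite ler_wpM2l.
have y3D : (A ^+ 4) v v <= 3 * D * D by apply: (le_trans c4); rewrite ler_wpM2l ?mulr_ge0.
have D2 : D ^+ 2 = D * D by rewrite expr2.
(* Makes 3 + 3, which costs 4 D deg, no worse than 2 + 4. *)
have D23 : 4 * D <= 3 * D ^+ 2.
  by have := ler_wpM2r D0 D_ge2; rewrite D2; lra.
case: k45 bk bk1 => ->; case: b b0 => [|[|[|[|b]]]] // _ _ _.
- rewrite -[(4 - 1)%N]/3%N -[(4 - 3)%N]/1%N c2 expr1 mulrC ler_wpM2r //; lra.
- rewrite -[(4 - 2)%N]/2%N -[(4 - 3)%N]/1%N c2 expr1 ler_wpM2r //; lra.
- by rewrite -[(5 - 1)%N]/4%N -[(5 - 3)%N]/2%N c2 mulrC ler_wpM2r // D2 mulrA.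
- rewrite -[(5 - 2)%N]/3%N -[(5 - 3)%N]/2%N; apply: le_trans (_ : 2 * D * (2 * deg v) <= _).
    by rewrite ler_pM.
  have -> : 2 * D * (2 * deg v) = 4 * D * deg v by ring.
  by rewrite ler_wpM2r.
- by rewrite -[(5 - 3)%N]/2%N c2 ler_wpM2r // D2 mulrA.
Qed.
End FewCommonNeighbours.
End Degenerate.

(** * Induced subgraphs and the plane case *)

(** Extend u by zero outside E and drop the output coordinates outside E; neither raises the
    norm. *)
Lemma quasirandom_induced (R : realType) (V : finType) (e : rel V) (E : {set V}) (q b : R) :
  0 <= b -> quasirandom e q (b ^+ 2) ->
  opnorm_le (adj R (fun i j : 'I_#|E| => e (enum_val i) (enum_val j)) - const_mx q^-1) b.
Proof.
move=> b0 he; split=> // u.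
pose v y := \sum_(i < #|E| | enum_val i == y) u i 0.
have vE i : v (enum_val i) = u i 0.
  rewrite /v (big_pred1 i) // => j; exact: (inj_eq enum_val_inj).
have v0 y : y \notin E -> v y = 0.
  move=> yE; rewrite /v big_pred0 // => i; apply: contraNF yE => /eqP <-.
  exact: enum_valP.
have := he v.
have -> : \sum_x v x ^+ 2 = nsq u.
  rewrite (bigID (mem E)) /= [X in _ + X]big1 => [|y /v0 ->]; last by rewrite expr0n.
  by rewrite addr0 big_enum_val; apply: eq_bigr => i _; rewrite vE expr2.
apply: le_trans; rewrite [leRHS](bigID (mem E)) /= ler_wpDr //.
  by apply: sumr_ge0 => x _; rewrite sqr_ge0.
rewrite big_enum_val le_eqVlt; apply/orP; left; apply/eqP; apply: eq_bigr => i _.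
rewrite -expr2; congr (_ ^+ 2);
  rewrite [RHS](bigID (mem E)) /= [X in _ = _ + X]big1 => [|y /v0 ->]; last by rewrite mulr0.
by rewrite addr0 big_enum_val mxE; apply: eq_bigr => j _; rewrite vE !mxE.
Qed.

Lemma path_loopless (T : eqType) (e : rel T) x p : uniq (x :: p) ->
  path (fun x y => (x != y) && e x y) x p = path e x p.
Proof.
elim: p x => //= y p IH x /andP[]; rewrite inE negb_or => /andP[-> _] u /=.
by rewrite IH.
Qed.

Lemma cycle_loopless (T : eqType) (e : rel T) p : uniq p -> (1 < size p)%N ->
  path.cycle (fun x y => (x != y) && e x y) p = path.cycle e p.
Proof.
case: p => [|x [|y p]] // u _; rewrite [LHS]/= [RHS]/= !rcons_path !path_loopless //.
  case/andP: u => xyp _; have -> : x != y.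
    by apply: contraNneq xyp => ->; rewrite inE eqxx.
  suff -> : last y p != x by [].
  by apply: contraNneq xyp => <-; rewrite mem_last.
by case/andP: u.
Qed.

Lemma ncycles_loopless (F : finFieldType) d (e : rel 'rV[F]_d) E n : (1 < n)%N ->
  ncycles e E n = ncycles (fun x y => (x != y) && e x y) E n.
Proof.
move=> n1; apply: eq_card => x; rewrite !inE; congr (_ && _).
by apply: andb_id2l => u; rewrite cycle_loopless // size_tuple.
Qed.

(** * Degrees and common neighbours in the plane *)

Section Plane.
Variable F : finFieldType.
Implicit Types x y z : 'rV[F]_2.
Local Notation i0 := (0 : 'I_2).
Local Notation i1 := (1 : 'I_2).

Lemma rV2_eq x y : x 0 i0 = y 0 i0 -> x 0 i1 = y 0 i1 -> x = y.
Proof.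
move=> h0 h1; apply/rowP => i; have [->|->] // : i = i0 \/ i = i1.
by case: i => [[|[|i]] hi] //; [left|right]; apply: val_inj.
Qed.

Lemma normsq2 x : normsq x = x 0 i0 ^+ 2 + x 0 i1 ^+ 2.
Proof. by rewrite /normsq !big_ord_recl big_ord0 addr0; congr (_ + x 0 _ ^+ 2);
  apply: val_inj. Qed.
Lemma dotp2 x y : dotp x y = x 0 i0 * y 0 i0 + x 0 i1 * y 0 i1.
Proof. by rewrite /dotp !big_ord_recl big_ord0 addr0; congr (_ + x 0 _ * y 0 _);
  apply: val_inj. Qed.

Lemma dist_degree2 t x : (#|[set z | dist_rel t x z]| <= 2 * #|F|)%N.
Proof.
rewrite -sum1dep_card (partition_big (fun z => z 0 i0) xpredT) //= mulnC -sum_nat_const.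
apply: leq_sum => a _; rewrite sum1dep_card.
apply: leq_trans (nsqrt_le2 (t - (x 0 i0 - a) ^+ 2)).
set Z := [set _ | _].
have inj : {in Z &, injective (fun z => x 0 i1 - z 0 i1)}.
  move=> z z'; rewrite !inE => /andP[_ /eqP za] /andP[_ /eqP za'] /addrI/oppr_inj h.
  by apply: rV2_eq; rewrite ?za.
rewrite -(card_in_imset inj); apply: subset_leq_card; apply/subsetP => _ /imsetP[z + ->].
rewrite !inE /dist_rel normsq2 !mxE => /andP[/eqP <- /eqP <-].
by rewrite addrAC subrr add0r.
Qed.

(* Two intersection points z0 and z0 + u of the circles differ by a vector
   orthogonal to the line of centres w, and lie symmetrically; an isotropic w
   would force p to be isotropic. *)
Lemma dist_codegree2 t x y : odd #|F| -> t != 0 -> x != y ->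
  (#|[set z | dist_rel t x z && dist_rel t z y]| <= 2)%N.
Proof.
move=> oF t0 xy; set Z := [set _ | _].
have two0 : 2 != 0 :> F := odd_card_2_neq0 oF.
have [->|/set0Pn[z0]] := eqVneq Z set0; first by rewrite cards0.
rewrite inE /dist_rel !normsq2 !mxE => /andP[/eqP pt /eqP pwt].
pose w0 := y 0 i0 - x 0 i0; pose w1 := y 0 i1 - x 0 i1.
pose p0 := x 0 i0 - z0 0 i0; pose p1 := x 0 i1 - z0 0 i1.
pose a := w0 ^+ 2 + w1 ^+ 2; pose b := 2 * (p1 * w0 - p0 * w1).
(* Writing z - z0 = l (-w1, w0), the circle equation becomes l (l a - b) = 0, and z1 is the solution
   l = b / a; when a = 0 the quotient is 0 and z1 = z0. *)
pose z1 : 'rV[F]_2 := \row_i (if i == i0 then z0 0 i0 - b / a * w1 else z0 0 i1 + b / a * w0).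
apply: (@leq_trans #|[set z0; z1]|); last by rewrite cards2; case: (_ != _).
apply: subset_leq_card; apply/subsetP => z.
rewrite !inE /dist_rel !normsq2 !mxE => /andP[/eqP ut /eqP uwt].
have [u0 u0E] : exists u0, z 0 i0 = z0 0 i0 + u0 by exists (z 0 i0 - z0 0 i0); ring.
have [u1 u1E] : exists u1, z 0 i1 = z0 0 i1 + u1 by exists (z 0 i1 - z0 0 i1); ring.
have pt' : p0 ^+ 2 + p1 ^+ 2 = t by [].
have h1 : u0 ^+ 2 + u1 ^+ 2 = 2 * (p0 * u0 + p1 * u1).
  apply/eqP; rewrite -subr_eq0; apply/eqP; transitivity (t - t); last by rewrite subrr.
  by rewrite -{1}ut -pt' u0E u1E /p0 /p1; ring.
have h2 : w0 * u0 + w1 * u1 = 0.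
  apply: (mulfI two0); rewrite mulr0; transitivity ((t - t) - (t - t)); last by rewrite !subrr.
  by rewrite -{1}ut -{1}pt -{1}uwt -{1}pwt u0E u1E /w0 /w1; ring.
have [l [l0 l1]] : exists l, u0 = - (l * w1) /\ u1 = l * w0.
  have [w00|w00] := eqVneq w0 0.
    have w10 : w1 != 0.
      apply: contraNneq xy => w10; apply/eqP; apply: rV2_eq; apply/esym/eqP; rewrite -subr_eq0.
        by rewrite -/w0 w00.
      by rewrite -/w1 w10.
    exists (- (u0 / w1)); split; first by field.
    by move: h2; rewrite w00 mul0r mulr0 add0r => /eqP; rewrite mulf_eq0 (negPf w10) => /eqP.
  exists (u1 / w0); split; last by field.
  apply: (mulfI w00); move/eqP: h2; rewrite addr_eq0 => /eqP ->; by field.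
have h3 : l * (l * a - b) = 0.
  apply/eqP; rewrite /a /b -(subrr (2 * (p0 * u0 + p1 * u1))) -{1}h1 l0 l1; apply/eqP; ring.
have [la|ln] := eqVneq l 0.
  apply/orP; left; apply/eqP; apply: rV2_eq; rewrite ?u0E ?u1E ?l0 ?l1 la mul0r ?oppr0 addr0 //.
move/eqP: h3; rewrite mulf_eq0 (negPf ln) subr_eq0 => /eqP lab.
have [a0|a0] := eqVneq a 0.
  have b0 : p1 * w0 - p0 * w1 = 0.
    by apply: (mulfI two0); rewrite mulr0 -/b -lab a0 mulr0.
  exfalso; move: t0; rewrite -pt'.
  have e1 : w0 ^+ 2 * (p0 ^+ 2 + p1 ^+ 2) = 0.
    transitivity (p0 ^+ 2 * a + (p1 * w0 - p0 * w1) * (p1 * w0 + p0 * w1));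
      first by rewrite /a; ring.
    by rewrite a0 b0 mulr0 mul0r addr0.
  have e2 : w1 ^+ 2 * (p0 ^+ 2 + p1 ^+ 2) = 0.
    transitivity (p1 ^+ 2 * a - (p1 * w0 - p0 * w1) * (p1 * w0 + p0 * w1));
      first by rewrite /a; ring.
    by rewrite a0 b0 mulr0 mul0r subr0.
  move/eqP: e1; rewrite mulf_eq0 => /orP[|/eqP ->]; last by rewrite eqxx.
  rewrite sqrf_eq0 => /eqP w00.
  move/eqP: e2; rewrite mulf_eq0 => /orP[|/eqP ->]; last by rewrite eqxx.
  rewrite sqrf_eq0 => /eqP w10; move: xy.
  have -> : x = y.
    by apply: rV2_eq; apply/esym/eqP; rewrite -subr_eq0; apply/eqP; [exact: w00|exact: w10].
  by rewrite eqxx.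
have lE : l = b / a by rewrite -lab mulfK.
by apply/orP; right; apply/eqP; apply: rV2_eq; rewrite mxE /= -?lE ?u0E ?u1E ?l0 ?l1.
Qed.

Lemma prod_degree2 t x : t != 0 -> (#|[set z | prod_rel t x z]| <= 2 * #|F|)%N.
Proof.
move=> t0; apply: (@leq_trans #|F|); last by rewrite leq_pmull.
have [x0|x0] := eqVneq (x 0 i0) 0; last first.
  rewrite -(card_in_imset (f := fun z => z 0 i1)); first exact: max_card.
  move=> z z'; rewrite !inE /prod_rel !dotp2 => /eqP h /eqP h' e1; apply: rV2_eq => //.
  by apply: (mulfI x0); move: h; rewrite -h' e1 => /addIr.
have [x1|x1] := eqVneq (x 0 i1) 0.
  rewrite (_ : [set z | _] = set0) ?cards0 //; apply/setP => z; rewrite !inE.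
  by rewrite /prod_rel dotp2 x0 x1 !mul0r addr0 eq_sym (negPf t0).
rewrite -(card_in_imset (f := fun z => z 0 i0)); first exact: max_card.
move=> z z'; rewrite !inE /prod_rel !dotp2 => /eqP h /eqP h' e1; apply: rV2_eq => //.
by apply: (mulfI x1); move: h; rewrite -h' e1 => /addrI.
Qed.

(** Both z and u = z - z' are orthogonal to x - y, hence parallel; but x.u = 0 while x.z = t is
    nonzero, so u = 0. *)
Lemma prod_codegree2 t x y : t != 0 -> x != y ->
  (#|[set z | prod_rel t x z && prod_rel t z y]| <= 2)%N.
Proof.
move=> t0 xy; apply: (@leq_trans 1) => //; apply/card_le1_eqP => z z'.
rewrite !inE /prod_rel !dotp2 => /andP[/eqP a1 /eqP a2] /andP[/eqP b1 /eqP b2].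
pose w0 := x 0 i0 - y 0 i0; pose w1 := x 0 i1 - y 0 i1.
pose u0 := z 0 i0 - z' 0 i0; pose u1 := z 0 i1 - z' 0 i1.
have e1 : w0 * u0 + w1 * u1 = 0.
  transitivity ((t - t) - (t - t)); last by rewrite !subrr.
  by rewrite -{1}a1 -{1}b1 -{1}a2 -{1}b2 /w0 /w1 /u0 /u1; ring.
have e2 : w0 * z 0 i0 + w1 * z 0 i1 = 0.
  by transitivity (t - t); [rewrite -{1}a1 -{1}a2 /w0 /w1; ring|rewrite subrr].
have e3 : x 0 i0 * u0 + x 0 i1 * u1 = 0.
  by transitivity (t - t); [rewrite -{1}a1 -{1}b1 /u0 /u1; ring|rewrite subrr].
have det : u0 * z 0 i1 = u1 * z 0 i0.
  have d0 : w0 * (u0 * z 0 i1 - u1 * z 0 i0) = 0.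
    transitivity ((w0 * u0 + w1 * u1) * z 0 i1 - u1 * (w0 * z 0 i0 + w1 * z 0 i1)); first ring.
    by rewrite e1 e2 mul0r mulr0 subr0.
  have d1 : w1 * (u0 * z 0 i1 - u1 * z 0 i0) = 0.
    transitivity (u0 * (w0 * z 0 i0 + w1 * z 0 i1) - (w0 * u0 + w1 * u1) * z 0 i0); first ring.
    by rewrite e1 e2 mul0r mulr0 subr0.
  move/eqP: d0; rewrite mulf_eq0 => /orP[/eqP w00|]; last by rewrite subr_eq0 => /eqP.
  move/eqP: d1; rewrite mulf_eq0 => /orP[/eqP w10|]; last by rewrite subr_eq0 => /eqP.
  case/eqP: xy; apply: rV2_eq; apply/eqP; rewrite -subr_eq0;
    [rewrite -/w0 w00|rewrite -/w1 w10] => //.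
apply: rV2_eq; apply/esym/eqP; rewrite -subr_eq0; apply/eqP; apply: (mulfI t0);
  rewrite mulr0 -a1.
  transitivity (z 0 i0 * (x 0 i0 * u0 + x 0 i1 * u1) + x 0 i1 * (u0 * z 0 i1 - u1 * z 0 i0)).
    by rewrite /u0 /u1; ring.
  by rewrite e3 det subrr !mulr0 addr0.
transitivity (z 0 i1 * (x 0 i0 * u0 + x 0 i1 * u1) - x 0 i0 * (u0 * z 0 i1 - u1 * z 0 i0)).
  by rewrite /u0 /u1; ring.
by rewrite e3 det subrr !mulr0 subr0.
Qed.
End Plane.

(** * Asymptotics *)

Lemma eventually_le_powR (R : realType) (c s : R) : 0 < s ->
  exists q0 : nat, forall q : nat, (q0 <= q)%N -> c <= q%:R `^ s.
Proof.
move=> s0; have [c0|c0] := leP c 0.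
  by exists 0%N => q _; rewrite (le_trans c0) // powR_ge0.
exists (Num.truncn (c `^ s^-1)).+1 => q hq.
have -> : c = (c `^ s^-1) `^ s by rewrite -powRrM mulVf ?gt_eqF // powRr1 // ltW.
apply: ge0_ler_powR; rewrite ?nnegrE ?powR_ge0 // ltW //.
by rewrite (lt_le_trans (truncnS_gt _)) // ler_nat.
Qed.

Lemma gainE (R : realType) n : (4 <= n)%N -> gain R n = 1 - 2 / (n%:R - 2).
Proof.
move=> n4; have nE := odd_double_half n; rewrite /gain.
have k2 : (2 <= n./2)%N by rewrite -(leq_double 2) in n4 *; lia.
have : 2 <= (n./2)%:R :> R by rewrite ler_nat.
have nR : n%:R = (if odd n then 1 else 0) + 2 * (n./2)%:R :> R.
  by rewrite -{1}nE natrD -mul2n natrM; case: (odd n).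
rewrite nR; move: (n./2)%:R => k k2R.
have nz (x : R) : 0 < x -> x != 0 by move=> x0; rewrite gt_eqF.
by case: (odd n); field; rewrite ?andbT; do ?[apply/andP; split]; apply: nz; lra.
Qed.

Ltac nonneg := repeat first [by [] | apply: exprn_ge0 | apply: mulr_ge0 | apply: addr_ge0].

(** * Error terms relative to the main term *)

Section Estimates.
Variable R : realType.
Implicit Types (q S beta x y w : R) (n : nat).

(** Here y bounds beta / (2 S) and w bounds q y^(n-2). Each of the three summands of the
    Hilbert-Schmidt bound is at most q S^2, whence the factor 3. *)
Lemma trace_error_le n q S beta y w :
  (4 <= n)%N -> 1 <= q -> 0 < S -> 0 <= beta -> beta <= 2 * y * S -> 2 * y <= 1 ->
  q * y ^+ (n - 2) <= w ->
  beta ^+ (n - 2) * (q * S ^+ 2 + q * S * beta + S ^+ 2)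
    + 2 * n%:R * (S * (beta * (S + beta) ^+ (n - 2)))
  <= S ^+ n * (3 * 2 ^+ (n - 2) * w + n%:R * 2 ^+ n * y).
Proof.
move=> n4 q1 S0 b0 bS y1 yw; have [m nE] : exists m, n = m.+2 by exists (n - 2)%N; lia.
rewrite nE -addn2 addnK addn2 in yw *; rewrite [leRHS]mulrDr.
have bS1 : beta <= S by apply: (le_trans bS); rewrite -[leRHS]mul1r ler_wpM2r // ltW.
have y0 : 0 <= y.
  have : 0 <= 2 * y * S by apply: le_trans bS.
  by rewrite pmulr_lge0 // pmulr_rge0.
have S1 := ltW S0.
apply: lerD.
  apply: le_trans (_ : (2 * y * S) ^+ m * (3 * q * S ^+ 2) <= _).
    have q0 : 0 <= q by rewrite (le_trans ler01).
    apply: ler_pM; first by rewrite exprn_ge0.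
    - by do ?apply: addr_ge0; do ?apply: mulr_ge0; rewrite ?exprn_ge0.
    - by rewrite lerXn2r ?nnegrE ?mulr_ge0.
    have h1 : q * S * beta <= q * S ^+ 2.
      by rewrite expr2 mulrA ler_wpM2l // mulr_ge0 // (le_trans ler01).
    have h2 : S ^+ 2 <= q * S ^+ 2 by rewrite ler_peMl ?sqr_ge0.
    lra.
  have -> : (2 * y * S) ^+ m * (3 * q * S ^+ 2) = S ^+ m.+2 * (3 * 2 ^+ m) * (q * y ^+ m).
    by rewrite !exprMn !exprS; ring.
  by rewrite [leRHS]mulrA ler_wpM2l //; nonneg.
have -> : S ^+ m.+2 * (m.+2%:R * 2 ^+ m.+2 * y) =
    2 * m.+2%:R * (S * ((2 * y * S) * (2 * S) ^+ m)).
  by rewrite exprMn !exprS; ring.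
apply: ler_wpM2l; first by nonneg.
apply: ler_wpM2l => //; apply: ler_pM => //; first by nonneg.
by rewrite lerXn2r ?nnegrE; [|nonneg|nonneg|lra].
Qed.

Lemma degenerate_error_le n q S beta y :
  (2 <= n)%N -> 1 <= q -> 0 < S -> 0 <= beta -> beta <= S -> q / S <= y ->
  n%:R ^+ 2 * ((S + beta) ^+ (n - 2) * (S * q)) <= S ^+ n * (n%:R ^+ 2 * 2 ^+ n * y).
Proof.
move=> n2 q1 S0 b0 bS qS; have [m nE] : exists m, n = m.+2 by exists (n - 2)%N; lia.
rewrite nE -addn2 addnK addn2; have S1 := ltW S0.
have q0 : 0 <= q by rewrite (le_trans ler01).
have y0 : 0 <= y by apply: le_trans qS; rewrite divr_ge0.
have qy : q <= y * S by rewrite -ler_pdivrMr.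
apply: le_trans (_ : m.+2%:R ^+ 2 * ((2 * S) ^+ m * (S * (y * S))) <= _).
  apply: ler_wpM2l; first by nonneg.
  apply: ler_pM; [by nonneg|by nonneg| |by rewrite ler_wpM2l].
  by rewrite lerXn2r ?nnegrE; [|nonneg|nonneg|lra].
have -> : S ^+ m.+2 * (m.+2%:R ^+ 2 * 2 ^+ m.+2 * y) =
   4 * (m.+2%:R ^+ 2 * ((2 * S) ^+ m * (S * (y * S)))) by rewrite exprMn !exprS; ring.
by rewrite ler_peMl ?ler1n //; nonneg.
Qed.

Lemma plane_degenerate_error_le n q S beta z :
  (4 <= n)%N -> 1 <= q -> 0 < S -> 0 <= beta -> beta <= S -> q ^+ (n - 3) <= z * S ^+ (n - 2) ->
  n%:R ^+ 2 * (3 * (2 * q) ^+ (n - 4) * ((S + beta) * (S * q))) <= S ^+ n * (n%:R ^+ 2 * 6 * 2 ^+ n * z).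
Proof.
move=> n4 q1 S0 b0 bS qS; have [m nE] : exists m, n = m.+4 by exists (n - 4)%N; lia.
rewrite {n n4}nE -addn4 addnK in qS *; have S1 := ltW S0.
have q0 : 0 <= q by rewrite (le_trans ler01).
rewrite (_ : m + 4 - 3 = m.+1)%N in qS; last by lia.
rewrite (_ : m + 4 - 2 = m.+2)%N in qS; last by lia.
rewrite addn4.
apply: le_trans (_ : m.+4%:R ^+ 2 * (3 * (2 * q) ^+ m * ((2 * S) * (S * q))) <= _).
  apply: ler_wpM2l; first by nonneg.
  apply: ler_wpM2l; first by nonneg.
  by apply: ler_wpM2r; [nonneg|lra].
have -> : m.+4%:R ^+ 2 * (3 * (2 * q) ^+ m * ((2 * S) * (S * q))) =
  m.+4%:R ^+ 2 * 6 * 2 ^+ m * S ^+ 2 * q ^+ m.+1 by rewrite exprMn !exprS; ring.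
apply: le_trans (_ : m.+4%:R ^+ 2 * 6 * 2 ^+ m * S ^+ 2 * (z * S ^+ m.+2) <= _).
  by apply: ler_wpM2l => //; nonneg.
have z0 : 0 <= z.
  have : 0 <= z * S ^+ m.+2 by apply: le_trans qS; rewrite exprn_ge0.
  by rewrite pmulr_lge0 // exprn_gt0.
have -> : S ^+ m.+4 * (m.+4%:R ^+ 2 * 6 * 2 ^+ m.+4 * z) =
  16 * (m.+4%:R ^+ 2 * 6 * 2 ^+ m * S ^+ 2 * (z * S ^+ m.+2)) by rewrite !exprS; ring.
by rewrite ler_peMl ?ler1n //; nonneg.
Qed.

(** 2^(n-2) is at most 8 * 4^(n./2 - 2), well below the powers of 6 in [bigK]; the surplus 3 leaves
    room for lower-order errors of size at most w. *)
Lemma bigK_ge n : (4 <= n)%N -> 3 * 2 ^+ (n - 2) + 3 <= bigK R n.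
Proof.
move=> n4; rewrite /bigK; case: eqP => [->|n4']; first by rewrite -natrX; lra.
have nE := odd_double_half n.
have [j jE] : exists j, n./2 = j.+2 by exists (n./2 - 2)%N; lia.
have -> : (n - 2 = odd n + 2 * j.+1)%N by lia.
rewrite jE (_ : j.+2 - 2 = j)%N ?subn2 // exprD exprM; set a := 2 ^+ odd n.
have a2 : a <= 2 by rewrite /a; case: (odd n); rewrite ?expr1 ?expr0; lra.
have a0 : 0 <= a by rewrite exprn_ge0.
have -> : 2 ^+ 2 = 4 :> R by rewrite expr2; lra.
have j46 : 4 ^+ j <= 6 ^+ j :> R by rewrite lerXn2r ?nnegrE //; lra.
have j4 : 1 <= 4 ^+ j :> R by rewrite exprn_ege1 //; lra.
have jn : 0 <= j.+2%:R :> R by [].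
rewrite [4 ^+ j.+1]exprS; move: (4 ^+ j) (6 ^+ j) (j.+2%:R) j46 j4 jn => u v c; nra.
Qed.

Lemma smallc_ge1 n : (4 <= n)%N -> 1 <= smallc R n.
Proof.
move=> n4; rewrite /smallc -natrX -natrX -natrM ler1n muln_gt0 !expn_gt0 /=.
by rewrite andbT; apply/orP; left; lia.
Qed.
End Estimates.

(** * Arithmetic of the exponents *)

Section Exponents.
Variables (R : realType) (n : nat) (delta : R).
Hypothesis n_ge4 : (4 <= n)%N.
Hypothesis delta_gt0 : 0 < delta.
Hypothesis delta_lt : delta < 1 / (2 * (n./2)%:R ^+ 2).

(** The exponent by which beta / S beats the first error term; it pays for all constants attached to
    y. *)
Definition slack : R := 1 / (n%:R - 2) + delta / 2 - (n%:R / 2 - 1) * delta.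

Lemma half_bounds : 2 <= (n./2)%:R :> R /\ n%:R <= 2 * (n./2)%:R + 1 :> R.
Proof.
have nE := odd_double_half n; split.
  by rewrite ler_nat; lia.
by rewrite -natrM natr1 ler_nat; lia.
Qed.

(** Positivity means delta (n - 2)(n - 3) < 2. Since n <= 2 k + 1, the product (n - 2)(n - 3) is at
    most 4 k^2, and the bound on delta gives exactly delta * 4 k^2 < 2. *)
Lemma slack_gt0 : 0 < slack.
Proof.
have [k2 nk] := half_bounds; have n4 : 4 <= n%:R :> R by rewrite ler_nat.
move: delta_lt; rewrite ltr_pdivlMr; last by rewrite mulr_gt0 // exprn_gt0 //; lra.
rewrite /slack; move: (n%:R) (n./2)%:R k2 nk n4 => m k k2 mk m4 dk.
have m2 : 0 < m - 2 by lra.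
suff : 0 < (1 / (m - 2) + delta / 2 - (m / 2 - 1) * delta) * (m - 2).
  by rewrite pmulr_lgt0.
have -> : (1 / (m - 2) + delta / 2 - (m / 2 - 1) * delta) * (m - 2) =
   1 - delta * ((m - 3) * (m - 2)) / 2 by field; rewrite gt_eqF.
have h : (m - 3) * (m - 2) <= 4 * k ^+ 2 by rewrite expr2; nra.
have : delta * ((m - 3) * (m - 2)) <= delta * (4 * k ^+ 2) by rewrite (ler_wpM2l (ltW delta_gt0)).
by lra.
Qed.

Lemma delta_le : delta < 1 / 8 /\ ((7 <= n)%N -> delta < 1 / 18).
Proof.
have [k2 _] := half_bounds; have k0 : 0 < 2 * (n./2)%:R ^+ 2 :> R.
  by rewrite mulr_gt0 // exprn_gt0 //; lra.
move: delta_lt; rewrite ltr_pdivlMr // => dk; split=> [|n7].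
  have : delta * 8 <= delta * (2 * (n./2)%:R ^+ 2); last by lra.
  by rewrite (ler_wpM2l (ltW delta_gt0)) //; move: (n./2)%:R k2 => k k2; rewrite expr2; nra.
have k3 : 3 <= (n./2)%:R :> R.
  by rewrite ler_nat; have := odd_double_half n; lia.
have : delta * 18 <= delta * (2 * (n./2)%:R ^+ 2); last by lra.
by rewrite (ler_wpM2l (ltW delta_gt0)) //; move: (n./2)%:R k3 => k k3; rewrite expr2; nra.
Qed.
End Exponents.

(** The first term covers degenerate walks, also in the plane, the second the mixed trace error, and
    2 ensures 2 y <= 1. It is beaten by q^slack in general, and by q^(1/2) and q^delta for n = 5 and
    n = 6 in the plane. *)
Definition estimate_const (R : realType) n : R := 6 * n%:R ^+ 2 * 2 ^+ n + n%:R * 2 ^+ n + 2.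

(** * Assembling the estimate *)

Section Estimate.
Variables (R : realType) (d n : nat) (delta : R).
Hypothesis d_ge2 : (2 <= d)%N.
Hypothesis n_ge4 : (4 <= n)%N.
Let n_pred : n = n.-1.+1. Proof. by lia. Qed.
Let pred_ge3 : (3 <= n.-1)%N. Proof. by lia. Qed.
Let pred_sub k : (n.-1 - k = n - k.+1)%N. Proof. by lia. Qed.
Let n_eq4 : (n < 5)%N -> n = 4%N. Proof. by lia. Qed.
Let n_eq56 : (5 <= n)%N -> (n < 7)%N -> n = 5%N \/ n = 6%N. Proof. by lia. Qed.
Let pred_eq45 : (5 <= n)%N -> (n < 7)%N -> n.-1 = 4%N \/ n.-1 = 5%N. Proof. by lia. Qed.
Let d_eq2 : (d < 3)%N -> d = 2%N. Proof. by lia. Qed.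
Hypothesis delta_gt0 : 0 < delta.
Hypothesis delta_lt : delta < 1 / (2 * (n./2)%:R ^+ 2).
Variables (F : finFieldType) (E : {set 'rV[F]_d}) (e : rel 'rV[F]_d).
Let q : R := #|F|%:R.
Let C := estimate_const R n.
Hypothesis large_slack : C <= q `^ slack n delta.
Hypothesis large_half : C <= q `^ (1 / 2).
Hypothesis large_delta : C <= q `^ delta.
Hypothesis E_large : size_threshold #|F| d n delta <= #|E|%:R.
Hypothesis e_sym : symmetric e.
Hypothesis e_irr : irreflexive e.
Hypothesis e_quasi : quasirandom e q (4 * q ^+ d.-1).
Hypothesis e_plane : d = 2%N ->
  (forall x, (#|[set z | e x z]| <= 2 * #|F|)%N) /\
  (forall x y, x != y -> (#|[set z | e x z && e z y]| <= 2)%N).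

Let g : R := gain R n.
Let S : R := #|E|%:R / q.
Let beta : R := 2 * q `^ ((d%:R - 1) / 2).
(** Half of [eps n delta]: the size condition gives S >= q^((d-1)/2 + a), so that beta / (2 S) <=
    q^(-a). *)
Let a : R := 1 / (n%:R - 2) + delta / 2.
Let y : R := q `^ (- a).
Let w : R := q `^ (- ((n%:R / 2 - 1) * delta)).

Let q_gt1 : 1 < q. Proof. by rewrite ltr1n finNzRing_gt1. Qed.
Let q_ge1 : 1 <= q. Proof. exact: ltW. Qed.
Let q_gt0 : 0 < q. Proof. exact: lt_trans ltr01 _. Qed.
Let q_ge0 : 0 <= q. Proof. exact: ltW. Qed.
Let q_neq0 : q != 0. Proof. by rewrite gt_eqF. Qed.
Let powD r s : q `^ (r + s) = q `^ r * q `^ s.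
Proof. by rewrite powRD // q_neq0 implybT. Qed.
Let n4R : 4 <= n%:R :> R. Proof. by rewrite ler_nat. Qed.
Let n2_neq0 : n%:R - 2 != 0 :> R. Proof. by rewrite gt_eqF //; have := n4R; lra. Qed.
Let gE : g = 1 - 2 / (n%:R - 2). Proof. exact: gainE. Qed.

Let S_ge : q `^ ((d%:R - g + delta) / 2) <= S.
Proof.
rewrite /S ler_pdivlMr // -{2}[q]powRr1 // -powD.
apply: le_trans E_large; rewrite /size_threshold -/q -/g; apply: ler_powR => //.
by lra.
Qed.
Let S_gt0 : 0 < S. Proof. by apply: lt_le_trans S_ge; rewrite powR_gt0. Qed.
Let S_ge0 : 0 <= S. Proof. exact: ltW. Qed.
Let N_eq : #|E|%:R = S * q. Proof. by rewrite /S divfK. Qed.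
Let y_ge0 : 0 <= y. Proof. exact: powR_ge0. Qed.
Let w_ge0 : 0 <= w. Proof. exact: powR_ge0. Qed.
Let beta_ge0 : 0 <= beta. Proof. by rewrite mulr_ge0 ?powR_ge0. Qed.

Let beta_sqr : beta ^+ 2 = 4 * q ^+ d.-1.
Proof.
rewrite /beta exprMn -[(q `^ _) ^+ 2]powR_mulrn ?powR_ge0 // -powRrM -[q ^+ _]powR_mulrn //.
have -> : (d%:R - 1) / 2 * 2%:R = d.-1%:R :> R.
  by rewrite divfK ?pnatr_eq0 // -subn1 natrB // ltnW.
by congr (_ * _); ring.
Qed.

Let beta_le : beta <= 2 * y * S.
Proof.
rewrite /beta -mulrA ler_wpM2l //; apply: le_trans (ler_wpM2l y_ge0 S_ge).
rewrite /y -powD; apply: ler_powR => //; rewrite gE /a; lra.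
Qed.

Let yw : y = w * q `^ (- slack n delta).
Proof. by rewrite /y /w -powD; congr (_ `^ _); rewrite /slack /a; ring. Qed.

Let w_le1 : w <= 1.
Proof.
rewrite -(powRr0 q); apply: ler_powR => //; rewrite oppr_le0 mulr_ge0 ?ltW //.
by have := n4R; lra.
Qed.

Let C_ge : [/\ 0 <= n%:R * 2 ^+ n :> R, 0 <= n%:R ^+ 2 * 2 ^+ n :> R & 2 <= C].
Proof.
have h1 : 0 <= n%:R * 2 ^+ n :> R by nonneg.
have h2 : 0 <= n%:R ^+ 2 * 2 ^+ n :> R by nonneg.
split=> //; rewrite /C /estimate_const -mulrA; lra.
Qed.

Let Cy : C * y <= w.
Proof.
rewrite yw powRN mulrCA ler_piMr // ler_pdivrMr ?powR_gt0 // mul1r //.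
Qed.

Let y_half : 2 * y <= 1.
Proof.
have [_ _ C2] := C_ge; apply: le_trans w_le1; apply: le_trans Cy.
by rewrite ler_wpM2r.
Qed.

Let beta_leS : beta <= S.
Proof. by apply: (le_trans beta_le); rewrite -[leRHS]mul1r ler_wpM2r. Qed.

(** The summand 1/(n-2) of a cancels the factor q exactly; this fixes the exponent in the size
    condition. *)
Let q_yn : q * y ^+ (n - 2) <= w.
Proof.
rewrite -{1}[q]powRr1 // /y -powR_mulrn ?powR_ge0 // -powRrM -powD.
apply: ler_powR => //; rewrite natrB; last exact: leq_trans n_ge4.
have -> : 1 + - a * (n%:R - 2%:R) = - ((n%:R / 2 - 1) * delta).
  by rewrite /a; field.
by [].
Qed.

Let relE (i j : 'I_#|E|) := e (enum_val i) (enum_val j).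
Let relE_sym : symmetric relE. Proof. by move=> i j; exact: e_sym. Qed.
Let relE_irr : irreflexive relE. Proof. by move=> i; exact: e_irr. Qed.
Let relE_dev : opnorm_le (adj R relE - const_mx q^-1) beta.
Proof. by apply: quasirandom_induced => //; rewrite beta_sqr. Qed.

Let U : R := (ncycles e E n)%:R.
Let D : R := (#|[set x : n.-tuple 'I_#|E| | path.cycle relE x & ~~ uniq x]|)%:R.
Let err := 3 * 2 ^+ (n - 2) * w + n%:R * 2 ^+ n * y.

Let trace_estimate : `|U + D - S ^+ n| <= S ^+ n * err.
Proof.
have nE := n_pred.
have -> : U + D = \tr (adj R relE ^+ n).
  rewrite /U /D ncycles_induced -natrD [in RHS]nE -closed_walks_trace; congr _%:R.
  by rewrite nE -nondegenerate_count.
apply: (le_trans (trace_adj_bound relE_sym q_gt0 relE_dev _)); first exact: leq_trans n_ge4.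
exact: trace_error_le.
Qed.

Let D_ge0 : 0 <= D. Proof. exact: ler0n. Qed.

Let M_eq : #|E|%:R ^+ n / q ^+ n = S ^+ n.
Proof. by rewrite /S expr_div_n. Qed.

Let rel_ge z : z <= w -> z + 3 * 2 ^+ (n - 2) * w + n%:R * 2 ^+ n * y <= bigK R n * w.
Proof.
move=> zw; have := ler_wpM2r w_ge0 (bigK_ge R n_ge4); rewrite mulrDl.
have [h1 h2 _] := C_ge; have : n%:R * 2 ^+ n * y <= C * y.
  by rewrite ler_wpM2r // /C /estimate_const -mulrA; lra.
have := Cy; have := w_ge0; lra.
Qed.

Lemma rel_error_ge : bigK R n * w + smallc R n * q `^ (- ((d%:R - 3) / 2) - eps n delta)
  <= rel_error #|F| d n delta.
Proof.
rewrite /rel_error -/q lerD2r lerDl; nonneg; exact: powR_ge0.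
Qed.

Let smallc_term_ge0 : 0 <= smallc R n * q `^ (- ((d%:R - 3) / 2) - eps n delta).
Proof. by rewrite mulr_ge0 ?powR_ge0 // (le_trans ler01) // smallc_ge1. Qed.

Let estimate_of_D z : D <= S ^+ n * z -> z + err <= rel_error #|F| d n delta ->
  `|U - S ^+ n| <= S ^+ n * rel_error #|F| d n delta.
Proof.
move=> Dz zr; have Sn : 0 <= S ^+ n by rewrite exprn_ge0.
apply: le_trans (ler_wpM2l Sn zr); rewrite mulrDr.
have -> : U - S ^+ n = - D + (U + D - S ^+ n) by ring.
by rewrite (le_trans (ler_normD _ _)) // normrN (ger0_norm D_ge0) lerD.
Qed.

(** For d >= 3 the size condition already gives q / S <= y, so degenerate walks are absorbed like
    the mixed trace error. *)
Let estimate_space : (3 <= d)%N -> `|U - S ^+ n| <= S ^+ n * rel_error #|F| d n delta.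
Proof.
move=> d3; apply: (estimate_of_D (z := n%:R ^+ 2 * 2 ^+ n * y)).
  have nE := n_pred.
  apply: le_trans (_ : n%:R ^+ 2 * ((S + beta) ^+ (n - 2) * (S * q)) <= _).
    have := @degenerate_le R _ relE q beta relE_sym relE_irr q_gt0 relE_dev n.-1.
    by rewrite -nE -pred_sub subn1 -/S N_eq; apply; exact: pred_ge3.
  apply: degenerate_error_le => //; first exact: leq_trans n_ge4.
  rewrite ler_pdivrMr //; apply: le_trans (ler_wpM2l y_ge0 S_ge).
  rewrite /y -powD -{1}[q]powRr1 //; apply: ler_powR => //; rewrite gE /a.
  have : 3 <= d%:R :> R by rewrite ler_nat.
  by lra.
apply: le_trans rel_error_ge; apply: ler_wpDr => //.
rewrite /err addrA; apply: rel_ge; apply: le_trans Cy.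
have [h1 h2 _] := C_ge; rewrite ler_wpM2r // /C /estimate_const -mulrA; lra.
Qed.

Let estimate_plane : d = 2%N -> `|U - S ^+ n| <= S ^+ n * rel_error #|F| d n delta.
Proof.
move=> d2; have [deg2 codeg2] := e_plane d2.
have Sn : 0 <= S ^+ n by rewrite exprn_ge0.
have dR : d%:R = 2 :> R by rewrite d2.
have [n7|n6] := leqP 7 n.
  (* The exponent is 1/2 - 2/(n-2) - delta, positive because 2/5 + 1/18 < 1/2. *)
  have c1 : 1 <= smallc R n * q `^ (- ((d%:R - 3) / 2) - eps n delta).
    rewrite -[leLHS]mulr1; apply: ler_pM => //; first exact: smallc_ge1.
    rewrite -[leLHS](powRr0 q); apply: ler_powR => //; rewrite /eps -/g gE dR.
    have := (delta_le n_ge4 delta_gt0 delta_lt).2 n7.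
    have n7R : 7 <= n%:R :> R by rewrite ler_nat.
    have : 2 / (n%:R - 2) <= 2 / 5 :> R by rewrite ler_pM2l // lef_pV2 ?posrE //; lra.
    by lra.
  have kw : err <= bigK R n * w by have := rel_ge w_ge0; rewrite add0r.
  have r1 : 1 <= rel_error #|F| d n delta.
    apply: le_trans rel_error_ge; apply: le_trans c1 _; rewrite lerDr.
    by apply: le_trans kw; rewrite /err; nonneg.
  rewrite ler_norml; apply/andP; split.
    have : 0 <= U by exact: ler0n.
    have : S ^+ n <= S ^+ n * rel_error #|F| d n delta by rewrite ler_peMr.
    by lra.
  apply: le_trans (_ : S ^+ n * err <= _).
    by have := le_trans (ler_norm _) trace_estimate; have := D_ge0; lra.
  by rewrite ler_wpM2l //; apply: le_trans rel_error_ge; apply: ler_wpDr.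
have [n5|n5] := leqP 5 n; last first.
  have n4 := n_eq4 n5.
  (* For n = 4 the gain is 0 and the threshold is q^(2 + delta/2), more than the whole plane. *)
  have : #|E|%:R <= q `^ 2%:R.
    rewrite powR_mulrn // -natrX ler_nat (leq_trans (max_card _)) //.
    by rewrite card_mx d2 mul1n.
  rewrite leNgt => /negP[]; apply: lt_le_trans E_large.
  have -> : size_threshold #|F| d n delta = q `^ 2%:R * q `^ (delta / 2).
    rewrite /size_threshold -/q -/g gE dR n4 -powD; congr (_ `^ _); by field.
  have h : 1 `^ (delta / 2) < q `^ (delta / 2).
    by apply: gt0_ltr_powR; rewrite ?nnegrE ?divr_gt0.
  by rewrite ltr_pMr ?powR_gt0 //; move: h; rewrite powR1.
(* The power of q is q^(n-3) / S^(n-2) evaluated at the smallest S allowed. *)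
pose z := 6 * n%:R ^+ 2 * 2 ^+ n * q `^ (n%:R / 2 - 3 - (n%:R / 2 - 1) * delta).
apply: (estimate_of_D (z := z)).
  have nE := n_pred.
  apply: le_trans (_ : n%:R ^+ 2 * (3 * (2 * q) ^+ (n - 4) * ((S + beta) * (S * q))) <= _).
    have := @degenerate_le_codegree R _ relE q beta relE_sym relE_irr q_gt0 relE_dev (2 * q) _ _ _ n.-1.
    rewrite -nE pred_sub -/S N_eq; apply.
    - by have := q_ge1; lra.
    - move=> v; rewrite -natrM ler_nat; apply: leq_trans (deg2 (enum_val v)).
      rewrite -(card_imset _ enum_val_inj); apply: subset_leq_card.
      by apply/subsetP => _ /imsetP[i + ->]; rewrite !inE.
    - move=> i j ij; have ij' : enum_val i != enum_val j by rewrite (inj_eq enum_val_inj).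
      apply: leq_trans (codeg2 _ _ ij'); rewrite -(card_imset _ enum_val_inj).
      by apply: subset_leq_card; apply/subsetP => _ /imsetP[l + ->]; rewrite !inE.
    exact: pred_eq45.
  have -> : S ^+ n * z = S ^+ n * (n%:R ^+ 2 * 6 * 2 ^+ n *
      q `^ (n%:R / 2 - 3 - (n%:R / 2 - 1) * delta)) by rewrite /z; ring.
  apply: plane_degenerate_error_le => //.
  have Spow : (q `^ ((d%:R - g + delta) / 2)) ^+ (n - 2) <= S ^+ (n - 2).
    by rewrite lerXn2r ?nnegrE ?powR_ge0.
  apply: le_trans (ler_wpM2l (powR_ge0 _ _) Spow).
  rewrite -!powR_mulrn ?powR_ge0 // -powRrM -powD; apply: ler_powR => //.
  rewrite !natrB ?(ltnW n5) ?(leq_trans _ n5) // gE dR le_eqVlt; apply/orP; left; apply/eqP;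
    field.
  exact: n2_neq0.
have -> : z + err = z + 3 * 2 ^+ (n - 2) * w + n%:R * 2 ^+ n * y by rewrite /err addrA.
have zC : z <= C * q `^ (n%:R / 2 - 3 - (n%:R / 2 - 1) * delta).
  have [h1 _ _] := C_ge; rewrite /z ler_wpM2r ?powR_ge0 // /C /estimate_const; lra.
(* For n = 5, z is at most C q^(-1/2) w. For n = 6 it may be C w, which exceeds w, but the third
   error term has exponent -delta against -2 delta and absorbs it. *)
have [n5E|n6E] : n = 5%N \/ n = 6%N := n_eq56 n5 n6.
  apply: le_trans rel_error_ge; apply: ler_wpDr => //; apply: rel_ge.
  apply: (le_trans zC); apply: (le_trans (ler_wpM2r (powR_ge0 _ _) large_half)).
  by rewrite -powD; apply: ler_powR => //; rewrite n5E; lra.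
apply: le_trans rel_error_ge; rewrite -addrA addrC; apply: lerD.
  by have := rel_ge w_ge0; rewrite add0r.
apply: (le_trans zC); apply: (le_trans (ler_wpM2r (powR_ge0 _ _) large_delta)).
apply: le_trans (_ : 1 * q `^ (- ((d%:R - 3) / 2) - eps n delta) <= _); last first.
  by rewrite ler_wpM2r ?powR_ge0 // smallc_ge1.
rewrite mul1r -powD; apply: ler_powR => //; rewrite /eps -/g gE dR n6E.
have -> : 2 / (6%:R - 2) = 1 / 2 :> R by field.
by lra.
Qed.

Lemma cycles_estimate :
  `|U - #|E|%:R ^+ n / q ^+ n| <= #|E|%:R ^+ n / q ^+ n * rel_error #|F| d n delta.
Proof.
rewrite M_eq; have [d3|d3] := leqP 3 d; first exact: estimate_space.
by apply/estimate_plane/d_eq2.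
Qed.
End Estimate.

Lemma dist_rel_sym (F : finFieldType) d (t : F) : symmetric (@dist_rel F d t).
Proof.
move=> x y; rewrite /dist_rel; congr (_ == t).
by apply: eq_bigr => i _; rewrite !mxE -sqrrN opprB.
Qed.

Lemma dist_rel_irr (F : finFieldType) d (t : F) : t != 0 -> irreflexive (@dist_rel F d t).
Proof.
move=> t0 x; rewrite /dist_rel subrr /normsq big1 ?[0 == t]eq_sym ?(negPf t0) // => i _.
by rewrite mxE expr0n.
Qed.

Lemma prod_rel_sym (F : finFieldType) d (t : F) : symmetric (@prod_rel F d t).
Proof. by move=> x y; rewrite /prod_rel dotpC. Qed.

(* In characteristic 2 one has normsq x = (\sum_i x 0 i) ^+ 2, so for odd n the
   distance graph on the whole space has no closed walk of length n and the
   distance estimate fails; hence the usual assumption that q is odd, needed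
   for the distance estimate only. *)
Theorem theorem1p3 (R : realType) (d n : nat) (delta : R)
    (d_ge2 : (2 <= d)%N) (n_ge4 : (4 <= n)%N)
    (delta_gt0 : 0 < delta)
    (delta_lt : delta < 1 / (2 * (n./2)%:R ^+ 2)) :
  exists q0 : nat,
    forall (F : finFieldType) (t : F) (E : {set 'rV[F]_d}),
      (q0 <= #|F|)%N ->
      t != 0 ->
      size_threshold #|F| d n delta <= #|E|%:R ->
      let M : R := #|E|%:R ^+ n / #|F|%:R ^+ n in
      (odd #|F| ->
        `| (Ndist E t n)%:R - M | <= M * rel_error #|F| d n delta) /\
      `| (Nprod E t n)%:R - M | <= M * rel_error #|F| d n delta.
Proof.
have [q1 hq1] := eventually_le_powR (estimate_const R n) (slack_gt0 n_ge4 delta_gt0 delta_lt).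
have [q2 hq2] := eventually_le_powR (estimate_const R n) (divr_gt0 ltr01 (ltr0Sn R 1)).
have [q3 hq3] := eventually_le_powR (estimate_const R n) delta_gt0.
exists (maxn q1 (maxn q2 q3)) => F t E; rewrite !geq_max => /and3P[/hq1 c1 /hq2 c2 /hq3 c3].
move=> t0 E_large M; have d_gt0 : (0 < d)%N := ltnW d_ge2.
split=> [oddF|].
  apply: (cycles_estimate d_ge2 n_ge4 delta_gt0 delta_lt c1 c2 c3 E_large).
  - exact: dist_rel_sym.
  - exact: dist_rel_irr.
  - exact: dist_quasirandom.
  move=> d2; subst d; split=> [x|x y xy]; first exact: dist_degree2.
  exact: dist_codegree2.
rewrite /Nprod ncycles_loopless; last exact: leq_trans n_ge4.
apply: (cycles_estimate d_ge2 n_ge4 delta_gt0 delta_lt c1 c2 c3 E_large).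
- by move=> x y; rewrite eq_sym prod_rel_sym.
- by move=> x; rewrite eqxx.
- exact: prod_quasirandom.
move=> d2; subst d; split=> [x|x y xy].
  apply: leq_trans (prod_degree2 x t0); apply: subset_leq_card.
  by apply/subsetP => z; rewrite !inE => /andP[].
apply: leq_trans (prod_codegree2 t0 xy); apply: subset_leq_card.
by apply/subsetP => z; rewrite !inE => /andP[/andP[_ ->] /andP[_ ->]].
Qed.
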